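(* Let $\mathbb{F}$ be an algebraically closed field of characteristic $p>3$, let $n$ be a positive integer and $\underline{t}=(t_1,\ldots,t_n)$ an $n$-tuple of positive integers. Let $X$ be either the odd Hamiltonian superalgebra $HO(n,n;\underline{t})$ or the odd contact superalgebra $KO(n,n+1;\underline{t})$ over $\mathbb{F}$, where $X$ is a (finite-dimensional) simple Lie superalgebra. Then $X$ does not possess any nondegenerate associative form.
   Context: An associative form on a Lie superalgebra $X$ is a bilinear form $\lambda:X\times X\to\mathbb{F}$ with $\lambda([x,y],z)=\lambda(x,[y,z])$ for all $x,y,z\in X$. Put $\pi_i:=p^{t_i}-1$ and $\mathbb{A}(n;\underline{t}):=\{\alpha\in\mathbb{Z}_{\geq 0}^n\mid \alpha_i\leq \pi_i\}$. $\mathcal{O}(n;\underline{t})$ is the divided power algebra with $\mathbb{F}$-basis $\{x^{(\alpha)}\mid \alpha\in\mathbb{A}(n;\underline{t})\}$ and product $x^{(\alpha)}x^{(\beta)}=\prod_i\binom{\alpha_i+\beta_i}{\alpha_i}\,x^{(\alpha+\beta)}$ (zero if $\alpha+\beta\notin\mathbb{A}(n;\underline{t})$); $\varepsilon_i$ is the $i$-th unit vector and $x_i:=x^{(\varepsilon_i)}$ for $1\le i\le n$. For $k\ge 0$, $\Lambda(k)$ is the exterior superalgebra in odd variables $x_{n+1},\ldots,x_{n+k}$ and $\mathcal{O}(n,k;\underline{t}):=\mathcal{O}(n;\underline{t})\otimes\Lambda(k)$, an associative supercommutative superalgebra with $\mathcal{O}(n;\underline{t})$ even; $\mathrm{p}(\cdot)$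 denotes parity of a $\mathbb{Z}_2$-homogeneous element. $\partial_r$ is the superderivation of $\mathcal{O}(n,k;\underline{t})$ with $\partial_r(x^{(\alpha)})=x^{(\alpha-\varepsilon_r)}$ (zero if $\alpha_r=0$) and $\partial_r(x_s)=0$ for $s>n$ when $r\le n$; and $\partial_r(x_s)=\delta_{rs}$ for $s>n$, $\partial_r(x^{(\alpha)})=0$ when $r>n$. So $\partial_r$ is even for $r\le n$ and odd for $r>n$. $W(n,k;\underline{t}):=\{\sum_{r=1}^{n+k}f_r\partial_r\mid f_r\in\mathcal{O}(n,k;\underline{t})\}$, a Lie superalgebra under the supercommutator. Put $i':=i+n$ for $1\le i\le n$ and $i':=i-n$ for $n+1\le i\le 2n$. Odd Hamiltonian superalgebra: let $\mathrm{T_H}(a):=\sum_{i=1}^{2n}(-1)^{\mathrm{p}(\partial_i)\mathrm{p}(a)}\partial_i(a)\partial_{i'}$ (extended linearly). Then $HO(n,n;\underline{t}):=\{\mathrm{T_H}(a)\mid a\in\mathcal{O}(n,n;\underline{t})\}$, a subalgebra of $W(n,n;\underline{t})$, with $[\mathrm{T_H}(a),\mathrm{T_H}(b)]=\mathrm{T_H}(\mathrm{T_H}(a)(b))$. Odd contact superalgebra: with $\mathfrak{D}:=\sum_{i=1}^{2n}x_i\partial_i$ and, for $a\in\mathcal{O}(n,n+1;\underline{t})$, $\mathrm{T_K}(a):=\mathrm{T_H}(a)+(-1)^{\mathrm{p}(a)}\partial_{2n+1}(a)\mathfrak{D}+(\mathfrak{D}(a)-2a)\partial_{2n+1}$ (with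 $\mathrm{T_H}(a)$ given by the same formula), $KO(n,n+1;\underline{t}):=\{\mathrm{T_K}(a)\mid a\in\mathcal{O}(n,n+1;\underline{t})\}$, a subalgebra of $W(n,n+1;\underline{t})$, with $[\mathrm{T_K}(a),\mathrm{T_K}(b)]=\mathrm{T_K}(\mathrm{T_K}(a)(b)-(-1)^{\mathrm{p}(a)}2\partial_{2n+1}(a)b)$. *)

(* Defs.v *)
From HB Require Import structures.
From mathcomp Require Import all_boot all_order all_algebra.

Set Implicit Arguments.
Unset Strict Implicit.
Unset Printing Implicit Defensive.

Import GRing.Theory.
Local Open Scope ring_scope.

Section SuperOperators.

(* A super vector space is a vectType V with the projections pr false and     *)
(* pr true onto its even and odd parts; it induces a Z_2-grading on 'End(V).  *)
Variables (F : fieldType) (V : vectType F) (pr : bool -> 'End(V)).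

Definition end_part (c : bool) (D : 'End(V)) : 'End(V) :=
  \sum_(b : bool) (pr (b (+) c) \o D \o pr b)%VF.

Definition superbracket (D E : 'End(V)) : 'End(V) :=
  \sum_(b : bool) \sum_(c : bool)
    ((end_part b D \o end_part c E)%VF
     - (-1) ^+ (b && c) *: (end_part c E \o end_part b D)%VF).

Definition graded_subspace (I : {vspace 'End(V)}) : Prop :=
  forall c D, D \in I -> end_part c D \in I.

Definition graded_ideal (X I : {vspace 'End(V)}) : Prop :=
  [/\ (I <= X)%VS, graded_subspace I &
      forall D E, D \in X -> E \in I ->
        superbracket D E \in I /\ superbracket E D \in I].

Definition simple_superalgebra (X : {vspace 'End(V)}) : Prop :=
  (exists D E, [/\ D \in X, E \in X & superbracket D E != 0]) /\
  (forall I, graded_ideal X I -> I = 0%VS \/ I = X).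

(* HO and KO below are closed under superbracket, so on them vsproj X only    *)
(* repackages superbracket x y as an element of subvs_of X.                   *)
Definition sub_bracket (X : {vspace 'End(V)}) (x y : subvs_of X) : subvs_of X :=
  vsproj X (superbracket (vsval x) (vsval y)).

Definition associative_form (X : {vspace 'End(V)})
    (lam : {biscalar subvs_of X}) : Prop :=
  forall x y z, lam (sub_bracket x y) z = lam x (sub_bracket y z).

Definition nondegenerate_form (X : {vspace 'End(V)})
    (lam : {biscalar subvs_of X}) : Prop :=
  (forall x, (forall y, lam x y = 0) -> x = 0) /\
  (forall y, (forall x, lam x y = 0) -> y = 0).

End SuperOperators.

Section DividedPower.

Variables (F : fieldType) (p n k : nat) (t : 'I_n -> nat).

(* (alpha, S) indexes the basis element x^(alpha) x_S of O(n,k;t), where x_S  *)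
(* is the product of the odd variables x_(n+s), s in S, in increasing order.  *)
Definition basis_idx : finType :=
  ({dffun forall i : 'I_n, 'I_(p ^ t i)} * {set 'I_k})%type.

Definition Onk : vectType F := {ffun basis_idx -> F^o}.

Definition linext (V : vectType F) (h : basis_idx -> V) (f : Onk) : V :=
  \sum_b (f b : F) *: h b.

Fact linext_is_linear V h : linear (@linext V h).
Proof.
move=> a f g; rewrite /linext scaler_sumr -big_split /=.
by apply: eq_bigr => b _; rewrite !ffunE scalerDl scalerA.
Qed.

HB.instance Definition _ (V : vectType F) (h : basis_idx -> V) :=
  GRing.isLinear.Build F Onk V _ (@linext V h) (@linext_is_linear V h).

(* Zero when alpha is not in A(n;t). *)
Definition monomial (alpha : 'I_n -> nat) (S : {set 'I_k}) : Onk :=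
  [ffun b : basis_idx =>
     ([forall i, b.1 i == alpha i :> nat] && (b.2 == S))%:R : F^o].

Definition obasis (b : basis_idx) : Onk := monomial (fun i => b.1 i) b.2.

(* The sign sorts x_S x_T: it counts the pairs (u, v) in S * T with v < u. *)
Definition basis_mul (b c : basis_idx) : Onk :=
  if [disjoint b.2 & c.2] then
    ((-1) ^+ #|[set u : 'I_k * 'I_k |
                  [&& u.1 \in b.2, u.2 \in c.2 & (u.2 < u.1)%N]]|
     * \prod_(i < n) 'C(b.1 i + c.1 i, b.1 i)%:R)
    *: monomial (fun i => (b.1 i + c.1 i)%N) (b.2 :|: c.2)
  else 0.

Definition omul (f g : Onk) : Onk :=
  linext (fun c => linext (fun b => basis_mul b c) f) g.

HB.instance Definition _ f :=
  GRing.isLinear.Build F Onk Onk _ (omul f)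
    (@linext_is_linear Onk (fun c => linext (fun b => basis_mul b c) f)).

(* The variables: inl i is x_(i+1) (even), inr s is x_(n+s+1) (odd). *)
Definition var : Type := ('I_n + 'I_k)%type.

Definition ovar (r : var) : Onk :=
  match r with
  | inl i => monomial (fun j => (j == i : nat)) set0
  | inr s => monomial (fun=> 0%N) [set s]
  end.

(* For odd r, moving partial_r past the variables preceding x_s in x_T gives  *)
(* the sign.                                                                  *)
Definition basis_partial (r : var) (b : basis_idx) : Onk :=
  match r with
  | inl i => if b.1 i == 0%N :> nat then 0
             else monomial (fun j => (b.1 j - (j == i))%N) b.2
  | inr s => if s \in b.2 then
               (-1) ^+ #|[set u in b.2 | (u < s)%N]|
               *: monomial (fun j => b.1 j) (b.2 :\ s)
             else 0
  end.

Definition partial (r : var) : 'End(Onk) := linfun (linext (basis_partial r)).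

(* The operator g |-> f * D(g), i.e. the element f D of W(n,k;t). *)
Definition opmul (f : Onk) (D : 'End(Onk)) : 'End(Onk) :=
  (linfun (omul f) \o D)%VF.

Definition oparity (b : bool) : 'End(Onk) :=
  linfun (linext (fun c : basis_idx =>
                    if odd #|c.2| == b then obasis c else 0)).

End DividedPower.

(* The indices 1 .. 2n are 'I_n + 'I_n, and hvar embeds them into the         *)
(* indices 1 .. n+k.                                                          *)
Definition prime_idx (n : nat) (i : 'I_n + 'I_n) : 'I_n + 'I_n :=
  match i with inl j => inr j | inr j => inl j end.

Definition odd_idx (n : nat) (i : 'I_n + 'I_n) : bool :=
  if i is inr _ then true else false.

Definition hvar (n k : nat) (le_nk : (n <= k)%N) (i : 'I_n + 'I_n) : var n k :=
  match i with inl j => inl j | inr j => inr (widen_ord le_nk j) end.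

Section Contact.

Variables (F : fieldType) (p n : nat) (t : 'I_n -> nat).

Section Formulas.

Variables (k : nat) (le_nk : (n <= k)%N).
Local Notation O := (Onk F p k t).
Local Notation d i := (partial F p t (hvar le_nk i)).

Definition TH_basis (b : basis_idx p k t) : 'End(O) :=
  \sum_(i : 'I_n + 'I_n)
    (-1) ^+ (odd_idx i * #|b.2|)
    *: opmul (d i (obasis F b)) (d (prime_idx i)).

Definition TH : O -> 'End(O) := linext TH_basis.

HB.instance Definition _ :=
  GRing.isLinear.Build F O 'End(O) _ TH (linext_is_linear TH_basis).

Definition eulerD : 'End(O) :=
  \sum_(i : 'I_n + 'I_n) opmul (ovar F p t (hvar le_nk i)) (d i).

End Formulas.

Local Notation OK := (Onk F p n.+1 t).
Local Notation dlast := (partial F p t (inr ord_max : var n n.+1)).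
Local Notation DD := (eulerD (leqnSn n)).

Definition TK_basis (b : basis_idx p n.+1 t) : 'End(OK) :=
  TH (leqnSn n) (obasis F b)
  + (-1) ^+ #|b.2| *: opmul (dlast (obasis F b)) DD
  + opmul (DD (obasis F b) - 2%:R *: obasis F b) dlast.

Definition TK : OK -> 'End(OK) := linext TK_basis.

HB.instance Definition _ :=
  GRing.isLinear.Build F OK 'End(OK) _ TK (linext_is_linear TK_basis).

Definition HO : {vspace 'End(Onk F p n t)} := limg (linfun (TH (leqnn n))).

Definition KO : {vspace 'End(OK)} := limg (linfun TK).

End Contact.

(* Main.v *)
Require Import Defs.
From HB Require Import structures.
From mathcomp Require Import all_boot all_order all_algebra.
From mathcomp Require Import ring zify.
Import GRing.Theory.
Local Open Scope ring_scope.

(** Let [w] be the basis element of top degree, [h = x_1 x_{1'}], and for an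
    associative form [lam] put [phi a = lam (T w) (T a)], where [T] is [T_H] or
    [T_K].  Call weight of a monomial its degree in [x_1] minus its degree in
    [x_{1'}].  Then [- T h] multiplies each monomial by its weight and [w] has
    weight [-2] in [F], so associativity gives [phi b = 0] unless the monomial [b]
    has weight [2] in [F].  Next, [T x_{1'} = - A] with [A = d_1] for HO and
    [A = d_1 + x_{1'} d_{2n+1}] for KO, and [[T y, T x_{1'}] = T (A y)].  Grade by
    the degree in [x_1] plus the number of odd variables other than [x_{1'}]: [T y]
    raises this degree by [deg y - 1], so [[T w, T y] = 0] when [deg y >= 3], and
    hence [phi (A y) = 0] for these [y].  As [p >= 5], a monomial [b] of weight [2]
    is [d_1 y] for such a [y].  So [phi = 0], although [T w <> 0]. *)

Set Implicit Arguments.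
Unset Strict Implicit.
Unset Printing Implicit Defensive.

Import Order.TTheory Num.Theory.

(** * Monomials, sorting signs and the product of the divided power superalgebra *)

Section DividedPowerAlgebra.

Variables (F : fieldType) (p n k : nat) (t : 'I_n -> nat).
Local Notation O := (Onk F p k t).
Local Notation idx := (basis_idx p k t).
Local Notation mono := (@monomial F p n k t).
Local Notation ob := (@obasis F p n k t).
Local Notation mul := (@omul F p n k t).
Local Notation d := (partial F p t).

Lemma eq_monomial (a a' : 'I_n -> nat) S : a =1 a' -> mono a S = mono a' S.
Proof.
move=> eqa; apply/ffunP => b; rewrite !ffunE.
by under eq_forallb do rewrite eqa.
Qed.

Lemma obasisE (b c : idx) : ob b c = (c == b)%:R.
Proof.
rewrite ffunE; congr (_%:R); congr (nat_of_bool _).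
case: b c => [b1 b2] [c1 c2] /=; rewrite xpair_eqE; congr (_ && _).
apply/forallP/eqP => [eqbc | -> i]; last exact: eqxx.
by apply/ffunP => i; apply: val_inj; apply/eqP; apply: eqbc.
Qed.

Lemma monomial_obasis (a : 'I_n -> nat) S :
  (forall i, (a i < p ^ t i)%N) ->
  exists b : idx, [/\ mono a S = ob b, forall i, b.1 i = a i :> nat & b.2 = S].
Proof.
move=> lt_a.
exists ([ffun i => Ordinal (lt_a i)] : {dffun forall i : 'I_n, 'I_(p ^ t i)}, S).
split=> //= [|i]; last by rewrite ffunE.
by apply: eq_monomial => i; rewrite ffunE.
Qed.

Lemma monomial_out (a : 'I_n -> nat) S i : (p ^ t i <= a i)%N -> mono a S = 0.
Proof.
move=> le_a; apply/ffunP => b; rewrite !ffunE.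
case: forallP => // /(_ i) /eqP eqb; have := ltn_ord (b.1 i).
by rewrite eqb ltnNge le_a.
Qed.

(** This dichotomy lets later formulas on monomials be stated for arbitrary exponents: either an
    exponent overflows and the monomial is zero, or a genuine basis element is at hand. *)
Lemma monomialP (a : 'I_n -> nat) S :
  (exists i, (p ^ t i <= a i)%N) \/
  (exists b : idx, [/\ mono a S = ob b, forall i, b.1 i = a i :> nat & b.2 = S]).
Proof.
case: (altP (@forallP _ (fun i => (a i < p ^ t i)%N))) => [h|].
  by right; apply: monomial_obasis.
rewrite negb_forall => /existsP[i]; rewrite -leqNgt => le_a.
by left; exists i.
Qed.

Lemma obasis_expand (f : O) : f = \sum_b (f b : F) *: ob b.
Proof.
apply/ffunP => c; rewrite sum_ffunE (bigD1 c) //= big1 ?addr0 => [|b neb].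
  by rewrite ffunE obasisE eqxx [RHS]mulr1.
by rewrite ffunE obasisE eq_sym (negPf neb) [LHS]mulr0.
Qed.

Lemma linext_obasis (V : vectType F) (h : idx -> V) b : linext h (ob b) = h b.
Proof.
rewrite /linext (bigD1 b) //= big1 ?addr0 => [|c nec].
  by rewrite obasisE eqxx scale1r.
by rewrite obasisE (negPf nec) scale0r.
Qed.

Lemma linear_obasis_eq (V : lmodType F) (f g : {linear O -> V}) :
  (forall b, f (ob b) = g (ob b)) -> f =1 g.
Proof.
move=> eqfg x; rewrite (obasis_expand x) !linear_sum.
by apply: eq_bigr => b _; rewrite !linearZ /= eqfg.
Qed.

Lemma lfun_obasis_eq (V : vectType F) (f g : 'Hom(O, V)) :
  (forall b, f (ob b) = g (ob b)) -> f = g.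
Proof. by move=> eqfg; apply/lfunP; apply: linear_obasis_eq. Qed.

(** With the arguments swapped, linearity of the product in its left factor can be registered as a
    linear structure. *)
Definition omulr (g f : O) : O := mul f g.

Fact omulr_is_linear g : linear (omulr g).
Proof.
move=> a f f'; rewrite /omulr /omul /linext scaler_sumr -big_split /=.
apply: eq_bigr => c _; rewrite -!/(linext (fun b => basis_mul F b c) _).
by rewrite linearP scalerDr !scalerA mulrC.
Qed.

HB.instance Definition _ g :=
  GRing.isLinear.Build F O O _ (omulr g) (omulr_is_linear g).

Lemma omulPl a f g h : mul (a *: f + g) h = a *: mul f h + mul g h.
Proof. exact: (linearP (omulr h)). Qed.

Lemma omulPr a f g h : mul f (a *: g + h) = a *: mul f g + mul f h.
Proof. exact: linearP. Qed.

Lemma omul0r f : mul f 0 = 0.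
Proof. exact: linear0. Qed.

Lemma omulZr a f h : mul f (a *: h) = a *: mul f h.
Proof. exact: linearZ. Qed.

Lemma omulNr f h : mul f (- h) = - mul f h.
Proof. exact: linearN. Qed.

Lemma omulDr f g h : mul f (g + h) = mul f g + mul f h.
Proof. exact: linearD. Qed.

Lemma omul0l h : mul 0 h = 0.
Proof. exact: (linear0 (omulr h)). Qed.

Lemma omulZl a f h : mul (a *: f) h = a *: mul f h.
Proof. exact: (linearZ_LR (omulr h)). Qed.

Lemma omulNl f h : mul (- f) h = - mul f h.
Proof. exact: (linearN (omulr h)). Qed.

Lemma omulDl f g h : mul (f + g) h = mul f h + mul g h.
Proof. exact: (linearD (omulr h)). Qed.

Lemma obasis_ind (P : O -> Prop) :
  P 0 -> (forall a f g, P f -> P g -> P (a *: f + g)) ->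
  (forall b, P (ob b)) -> forall f, P f.
Proof.
move=> P0 Plin Pob f; rewrite (obasis_expand f).
by elim/big_rec: _ => [|b g _ Pg]; [exact: P0 | exact: Plin].
Qed.

Lemma omul_obasis b c : mul (ob b) (ob c) = basis_mul F b c.
Proof. by rewrite /omul !linext_obasis. Qed.

(** The contribution of a single pair of odd variables. The value 0 on a repeated variable encodes
    that its square is zero, so disjointness needs no separate test in products of signs. *)
Definition ecross (u v : 'I_k) : F :=
  if (v < u)%N then -1 else (u != v)%:R.

(* Vanishes unless S and T are disjoint, and is then the sign sorting x_S x_T. *)
Definition sort_sign (S T : {set 'I_k}) : F :=
  \prod_(u in S) \prod_(v in T) ecross u v.

Lemma ecrossC u v : ecross u v = - ecross v u.
Proof.
rewrite /ecross eq_sym; case: ltngtP => [||/val_inj->]; rewrite ?eqxx ?oppr0 //.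
- by case: eqP => [->|]; rewrite ?ltnn.
- by case: eqP => [->|]; rewrite ?ltnn // opprK.
Qed.

Lemma ecross_diag u : ecross u u = 0.
Proof. by rewrite /ecross ltnn eqxx. Qed.

Lemma sgn0 (S T : {set 'I_k}) : ~~ [disjoint S & T] -> sort_sign S T = 0.
Proof.
case/pred0Pn => u /andP[Su Tu].
by rewrite /sort_sign (bigD1 u) //= (bigD1 u) //= ecross_diag !mul0r.
Qed.

Lemma sgnE (S T : {set 'I_k}) : [disjoint S & T] ->
  sort_sign S T = (-1) ^+ #|[set u : 'I_k * 'I_k |
                  [&& u.1 \in S, u.2 \in T & (u.2 < u.1)%N]]|.
Proof.
move=> dST; rewrite /sort_sign pair_big_dep -prodr_const.
rewrite (eq_bigr (fun u : 'I_k * 'I_k => if (u.2 < u.1)%N then -1 else 1)) => [|[u v] /= /andP[Su Tv]].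
  rewrite -big_mkcondr; apply: eq_bigl => u; rewrite inE.
  by rewrite -andbA.
rewrite /ecross; case: ltnP => // _; case: eqP => // euv.
by have := disjointFr dST Su; rewrite euv Tv.
Qed.

Lemma sgn_set0l T : sort_sign set0 T = 1.
Proof. by rewrite /sort_sign big_set0. Qed.

Lemma sgn_set0r S : sort_sign S set0 = 1.
Proof. by rewrite /sort_sign big1 // => u _; rewrite big_set0. Qed.

Lemma sgn_set1 u v : sort_sign [set u] [set v] = ecross u v.
Proof. by rewrite /sort_sign !big_set1. Qed.

Lemma sgnUl (S T U : {set 'I_k}) : [disjoint S & T] -> sort_sign (S :|: T) U = sort_sign S U * sort_sign T U.
Proof.
move=> dST; rewrite /sort_sign (eq_bigl (fun u => u \in [predU S & T])).
  by rewrite bigU.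
by move=> u; rewrite !inE.
Qed.

Lemma sgnUr (S T U : {set 'I_k}) : [disjoint T & U] -> sort_sign S (T :|: U) = sort_sign S T * sort_sign S U.
Proof.
move=> dTU; rewrite /sort_sign -big_split; apply: eq_bigr => u _ /=.
by rewrite (eq_bigl (fun v => v \in [predU T & U])) ?bigU // => v; rewrite !inE.
Qed.

(** If [S], [T] and [T], [U] are disjoint, both sides are the product of the three pairwise signs;
    otherwise both sides vanish. *)
Lemma sgn_assoc S T U :
  sort_sign S T * sort_sign (S :|: T) U = sort_sign T U * sort_sign S (T :|: U).
Proof.
have [dST|ndST] := boolP [disjoint S & T]; last first.
  rewrite sgn0 // mul0r [sort_sign S (T :|: U)]sgn0 ?mulr0 //.
  by apply: contra ndST; apply: disjointWr; apply: subsetUl.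
have [dTU|ndTU] := boolP [disjoint T & U]; last first.
  rewrite [sort_sign T U]sgn0 // mul0r [sort_sign (S :|: T) U]sgn0 ?mulr0 //.
  by apply: contra ndTU; apply: disjointWl; apply: subsetUr.
by rewrite sgnUl // sgnUr //; ring.
Qed.

Lemma sgn1C s S : sort_sign S [set s] = (-1) ^+ #|S| * sort_sign [set s] S.
Proof.
rewrite /sort_sign big_set1 -prodr_const -big_split; apply: eq_bigr => u _ /=.
by rewrite big_set1 ecrossC mulN1r.
Qed.

Lemma sgn_sqr (S T : {set 'I_k}) : [disjoint S & T] -> sort_sign S T * sort_sign S T = 1.
Proof. by move=> dST; rewrite sgnE // -expr2 sqrr_sign. Qed.

Definition multibin (a b : 'I_n -> nat) : F :=
  \prod_(i < n) 'C(a i + b i, a i)%:R.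

(** Exponents may be out of range: an overflow in a factor is inherited by the sum, so both sides
    are then zero. Overlapping [S] and [T] are covered by the vanishing of [sort_sign]. *)
Lemma omul_monomial a b S T :
  mul (mono a S) (mono b T) =
    (sort_sign S T * multibin a b) *: mono (fun i => (a i + b i)%N) (S :|: T).
Proof.
case: (monomialP a S) => [[i ai]|[b1 [-> ea eS]]].
  rewrite (monomial_out S ai) omul0l.
  by rewrite (@monomial_out _ _ i) ?scaler0 // (leq_trans ai) ?leq_addr.
case: (monomialP b T) => [[i bi]|[b2 [-> eb eT]]].
  rewrite (monomial_out T bi) linear0.
  by rewrite (@monomial_out _ _ i) ?scaler0 // (leq_trans bi) ?leq_addl.
rewrite omul_obasis /basis_mul eS eT.
have [dST|ndST] := boolP [disjoint S & T]; last by rewrite sgn0 // mul0r scale0r.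
rewrite sgnE // /multibin; congr (_ * _ *: _).
  by apply: eq_bigr => i _; rewrite ea eb.
by apply: eq_monomial => i; rewrite ea eb.
Qed.

(** Both sides are products of trinomial coefficients. The identity is proved over the naturals,
    where factorials can be cancelled, and only then read in [F]. *)
Lemma mbin_assoc a b c :
  multibin a b * multibin (fun i => (a i + b i)%N) c =
    multibin b c * multibin a (fun i => (b i + c i)%N).
Proof.
rewrite /multibin -!big_split; apply: eq_bigr => i _ /=; rewrite -!natrM.
congr (_%:R); move: (a i) (b i) (c i) => {}a {}b {}c.
have fE x y : ('C(x + y, x) * (x`! * y`!) = (x + y)`!)%N.
  by rewrite -[in RHS](bin_fact (leq_addr y x)) addKn.
have := (fE (a + b)%N c, fE a b, fE a (b + c)%N, fE b c).
rewrite addnA => -[[[h1 h2] h3] h4].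
have ABC0 : (0 < a`! * (b`! * c`!))%N by rewrite !muln_gt0 !fact_gt0.
apply/eqP; rewrite -(eqn_pmul2r ABC0); apply/eqP.
transitivity ((a + b + c)`!); first by rewrite -h1 -h2; ring.
by rewrite -h3 -h4; ring.
Qed.

End DividedPowerAlgebra.

(** * Associativity, the parity automorphism and the Leibniz rules *)

Section Superderivations.

Variables (F : fieldType) (p n k : nat) (t : 'I_n -> nat).
Local Notation O := (Onk F p k t).
Local Notation idx := (basis_idx p k t).
Local Notation mono := (@monomial F p n k t).
Local Notation ob := (@obasis F p n k t).
Local Notation mul := (@omul F p n k t).
Local Notation d := (partial F p t).
Local Notation sgn := (sort_sign F).
Local Notation mbin := (multibin F).
Local Notation xi s := (ovar F p t (inr s : var n k)).

Lemma omulA f g h : mul (mul f g) h = mul f (mul g h).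
Proof.
elim/obasis_ind: f => [|a f f' IH IH'|b]; first by rewrite !omul0l.
  by rewrite !omulPl IH IH'.
elim/obasis_ind: g => [|a g g' IH IH'|b']; first by rewrite !(omul0l, omul0r).
  by rewrite omulPr !omulPl omulPr IH IH'.
elim/obasis_ind: h => [|a h h' IH IH'|b'']; first by rewrite !omul0r.
  by rewrite !omulPr IH IH'.
rewrite /obasis !omul_monomial omulZl omulZr !omul_monomial !scalerA.
rewrite setUA.
(* Separate signs from binomials, so that each group is reassociated by its own cocycle identity. *)
have -> : sgn b.2 b'.2 * mbin (fun i => b.1 i) (fun i => b'.1 i)
    * (sgn (b.2 :|: b'.2) b''.2 
       * mbin (fun i => (b.1 i + b'.1 i)%N) (fun i => b''.1 i))
  = (sgn b.2 b'.2 * sgn (b.2 :|: b'.2) b''.2)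
    * (mbin (fun i => b.1 i) (fun i => b'.1 i)
       * mbin (fun i => (b.1 i + b'.1 i)%N) (fun i => b''.1 i)) by ring.
rewrite sgn_assoc mbin_assoc.
rewrite (eq_monomial F p t _ (fun i => addnA (b.1 i) (b'.1 i) (b''.1 i))).
congr (_ *: _); ring.
Qed.

Lemma partial_obasis r b : d r (ob b) = basis_partial F r b.
Proof. by rewrite lfunE /= linext_obasis. Qed.

Lemma partial_odd s (a : 'I_n -> nat) S :
  d (inr s) (mono a S) =
    ((s \in S)%:R * sgn [set s] (S :\ s)) *: mono a (S :\ s).
Proof.
case: (monomialP F p t a S) => [[i ai]|[b [-> eb eS]]].
  by rewrite !(monomial_out F _ ai) linear0 scaler0.
rewrite partial_obasis /= eS; case: ifP => _; last by rewrite mul0r scale0r.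
rewrite (eq_monomial F p t _ eb) mul1r; congr (_ *: _).
rewrite /sort_sign big_set1 -prodr_const.
rewrite big_mkcond [RHS]big_mkcond; apply: eq_bigr => v _ /=.
rewrite !inE /ecross; case: (ltngtP v s) => [lt_vs|gt_vs|/val_inj->].
- by rewrite andbT -val_eqE /= (ltn_eqF lt_vs).
- by rewrite andbF -!val_eqE /= (gtn_eqF gt_vs) (ltn_eqF gt_vs) if_same.
- by rewrite eqxx andbF.
Qed.

(** The bound on [a i] matters at [a i = p ^ t i]: there the monomial is zero, while the lowered one
    need not be. *)
Lemma partial_even i (a : 'I_n -> nat) S : (a i < p ^ t i)%N ->
  d (inl i) (mono a S) =
    if a i == 0%N then 0 else mono (fun j => (a j - (j == i))%N) S.
Proof.
move=> lt_ai; case: (monomialP F p t a S) => [[j aj]|[b [-> eb eS]]].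
  rewrite !(monomial_out F _ aj) linear0; case: ifP => // _.
  have neji : j != i by apply: contraTneq aj => ->; rewrite -ltnNge.
  by rewrite (@monomial_out _ _ _ _ _ _ _ j) // (negPf neji) subn0.
rewrite partial_obasis /= eS eb; case: ifP => // _.
by apply: eq_monomial => j; rewrite eb.
Qed.

(** The parity automorphism. Signs depending on the parity of an argument become [sigma] applied to
    it, which keeps the formulas linear and valid on inhomogeneous elements. *)
Definition sigma : 'End(O) :=
  linfun (linext (fun b : idx => (-1) ^+ #|b.2| *: ob b)).

Lemma oparity_obasis e b :
  oparity F p k t e (ob b) = if odd #|b.2| == e then ob b else 0.
Proof. by rewrite lfunE /= linext_obasis. Qed.

Lemma sigma_monomial a S : sigma (mono a S) = (-1) ^+ #|S| *: mono a S.
Proof.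
case: (monomialP F p t a S) => [[i ai]|[b [-> eb <-]]].
  by rewrite !(monomial_out F _ ai) linear0 scaler0.
by rewrite lfunE /= linext_obasis.
Qed.

Lemma sigma_partial_even i f : sigma (d (inl i) f) = d (inl i) (sigma f).
Proof.
elim/obasis_ind: f => [|a f f' IH IH'|b]; first by rewrite !linear0.
  by rewrite !linearP /= IH IH'.
rewrite sigma_monomial linearZ /= !partial_obasis /=; case: ifP => _.
  by rewrite linear0 scaler0.
by rewrite sigma_monomial.
Qed.

Lemma sigma_partial_odd s (f : O) :
  sigma (d (inr s) f) = - d (inr s) (sigma f).
Proof.
suff /lfunP/(_ f) : (sigma \o d (inr s) = - (d (inr s) \o sigma))%VF.
  by rewrite opp_lfunE !comp_lfunE.
apply: lfun_obasis_eq => b; rewrite opp_lfunE !comp_lfunE.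
rewrite sigma_monomial ![d _ (_ *: _)]linearZ /= !partial_odd.
rewrite [sigma _]linearZ /= sigma_monomial.
rewrite !scalerA -scaleNr; case: (boolP (s \in b.2)) => sb; last first.
  by rewrite !(mul0r, mulr0) ?oppr0 ?scale0r ?oppr0.
by rewrite [in RHS](cardsD1 s) sb exprS; congr (_ *: _); ring.
Qed.

Lemma partial_even_comm i j (f : O) :
  d (inl i) (d (inl j) f) = d (inl j) (d (inl i) f).
Proof.
elim/obasis_ind: f => [|a f f' IH IH'|b]; first by rewrite !linear0.
  by rewrite !linearP /= IH IH'.
wlog: i j / b.1 i == 0%N :> nat => [hw|bi0]; last first.
  rewrite [d (inl i) (ob b)]partial_even // bi0 linear0 partial_even //.
  case: ifP => _; first by rewrite linear0.
  by rewrite partial_even (eqP bi0) //= (leq_ltn_trans _ (ltn_ord (b.1 i))).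
have [bi0|nbi0] := boolP (b.1 i == 0%N :> nat); first exact: hw.
have [bj0|nbj0] := boolP (b.1 j == 0%N :> nat); first by rewrite [RHS]hw.
have [->//|neij] := eqVneq i j.
have lt a (l : 'I_n) : (b.1 l - a < p ^ t l)%N.
  by rewrite (leq_ltn_trans (leq_subr _ _)).
rewrite !(@partial_even _ (fun i => b.1 i)) //.
rewrite (negPf nbi0) (negPf nbj0) !partial_even //.
rewrite [j == i]eq_sym !(negPf neij) !subn0 (negPf nbi0) (negPf nbj0).
by apply: eq_monomial => l; rewrite subnAC.
Qed.

Lemma partial_even_odd_comm i s (f : O) :
  d (inl i) (d (inr s) f) = d (inr s) (d (inl i) f).
Proof.
elim/obasis_ind: f => [|a f f' IH IH'|b]; first by rewrite !linear0.
  by rewrite !linearP /= IH IH'.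
rewrite partial_odd linearZ /= !partial_even //.
case: ifP => _; first by rewrite scaler0 linear0.
by rewrite partial_odd.
Qed.

Lemma partial_odd_anticomm r s (f : O) :
  d (inr r) (d (inr s) f) = - d (inr s) (d (inr r) f).
Proof.
suff /lfunP/(_ f) : (d (inr r) \o d (inr s) = - (d (inr s) \o d (inr r)))%VF.
  by rewrite opp_lfunE !comp_lfunE.
apply: lfun_obasis_eq => b; rewrite opp_lfunE !comp_lfunE.
rewrite !partial_odd ![d _ (_ *: _)]linearZ /= !partial_odd !scalerA -scaleNr.
have [->|ners] := eqVneq r s.
  by rewrite !inE eqxx /= mul0r mulr0 oppr0.
rewrite !inE ners eq_sym ners /= setDDl setUC -setDDl.
case: (boolP (r \in b.2)) => br; last by rewrite !(mul0r, mulr0) ?oppr0 ?scale0r ?oppr0.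
case: (boolP (s \in b.2)) => bs; last by rewrite !(mul0r, mulr0) ?oppr0 ?scale0r ?oppr0.
(* The two orders of removal share all other sign factors and differ in [ecross F s r] against
   [ecross F r s], which are opposite. *)
have sgnD u v (S : {set 'I_k}) : v \in S :\ u ->
    sgn [set u] (S :\ u) = ecross F u v * sgn [set u] (S :\ u :\ v).
  move=> Sv; rewrite -{1}(setD1K Sv) sgnUr ?sgn_set1 //.
  by rewrite disjoints1 !inE eqxx.
rewrite (sgnD s r) ?inE ?ners // (sgnD r s) ?inE 1?eq_sym ?ners //.
rewrite [ecross F s r]ecrossC (setDDl _ [set s]) [[set s] :|: _]setUC -setDDl.
by congr (_ *: _); ring.
Qed.

Lemma omul_xiC s f : mul f (xi s) = mul (xi s) (sigma f).
Proof.
elim/obasis_ind: f => [|a f f' IH IH'|b].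
- by rewrite omul0l linear0 omul0r.
- by rewrite omulPl linearP /= omulPr IH IH'.
rewrite sigma_monomial omulZr /= /obasis /= !omul_monomial scalerA.
rewrite sgn1C setUC /multibin !big1 => [|i _|i _]; first last.
- by rewrite addn0 binn.
- by rewrite add0n bin0.
rewrite !mulr1; congr (_ *: _).
by apply: eq_monomial => i; rewrite addnC.
Qed.

Lemma omul1l f : mul (mono (fun=> 0%N) set0) f = f.
Proof.
elim/obasis_ind: f => [|a f f' IH IH'|b].
- by rewrite omul0r.
- by rewrite omulPr IH IH'.
rewrite [ob b]/obasis omul_monomial sgn_set0l set0U /multibin big1 => [|i _].
  by rewrite mul1r scale1r.
by rewrite add0n bin0.
Qed.

Lemma sigma_omul f g : sigma (mul f g) = mul (sigma f) (sigma g).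
Proof.
elim/obasis_ind: f => [|a f f' IH IH'|b].
- by rewrite !(omul0l, linear0).
- by rewrite omulPl !linearP /= omulPl IH IH'.
elim/obasis_ind: g => [|a g g' IH IH'|c].
- by rewrite !(omul0r, linear0).
- by rewrite omulPr !linearP /= ?omulPr IH IH'.
rewrite !sigma_monomial omulZr omulZl !omul_monomial linearZ /=.
rewrite sigma_monomial !scalerA; congr (_ *: _).
have [dbc|ndbc] := boolP [disjoint b.2 & c.2]; last first.
  by rewrite sgn0 // !(mul0r, mulr0).
by rewrite cardsU (disjoint_setI0 dbc) cards0 subn0 exprD; ring.
Qed.

(** On monomials the proof compares sorting signs, according to which of the two factors contain the
    variable [s]. *)
Lemma partial_odd_omul s f g :
  d (inr s) (mul f g) = mul (d (inr s) f) g + mul (sigma f) (d (inr s) g).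
Proof.
elim/obasis_ind: f => [|a f f' IH IH'|b].
- by rewrite !(omul0l, linear0) add0r.
- by rewrite omulPl !linearP /= !omulPl IH IH' /= !scalerDr addrACA.
elim/obasis_ind: g => [|a g g' IH IH'|c].
- by rewrite !(omul0r, linear0) add0r.
- by rewrite omulPr !linearP /= ?omulPr IH IH' /= !scalerDr addrACA.
rewrite !omul_monomial linearZ /= !partial_odd sigma_monomial.
rewrite !(omulZl, omulZr) !omul_monomial !scalerA.
move: (multibin _ _ _) (fun i : 'I_n => (b.1 i + c.1 i)%N) => B m.
set S := b.2; set T := c.2.
have sgn_s (U : {set 'I_k}) : s \in U -> forall V : {set 'I_k},
    sgn U V = sgn [set s] V * sgn (U :\ s) V
    /\ sgn V U = sgn V [set s] * sgn V (U :\ s).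
  move=> Us V; rewrite -{1 3}(setD1K Us).
  by rewrite sgnUl ?sgnUr // disjoints1 !inE eqxx.
have sgn2 (U : {set 'I_k}) : s \notin U -> sgn [set s] U * sgn [set s] U = 1.
  by move=> Us; rewrite sgn_sqr // disjoints1.
have sD (U : {set 'I_k}) : s \notin U :\ s by rewrite !inE eqxx.
case: (boolP (s \in S)) => bs; case: (boolP (s \in T)) => cs.
(* The variable occurs in both factors: the product vanishes, and removing it from either factor
   leaves the same union, with opposite coefficients. *)
- rewrite sgn0; last by apply/pred0Pn; exists s; apply/andP.
  rewrite !mul0r scale0r.
  rewrite (_ : S :\ s :|: T = S :|: T); last first.
    by apply/setP => u; rewrite !inE; case: eqP => // ->; rewrite cs !orbT.
  rewrite (_ : S :|: T :\ s = S :|: T); last first.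
    by apply/setP => u; rewrite !inE; case: eqP => // ->; rewrite bs.
  rewrite -scalerDl -[LHS](scale0r (mono m (S :|: T))); congr (_ *: _).
  have [_ ->] := sgn_s T cs (S :\ s); have [-> _] := sgn_s S bs (T :\ s).
  rewrite sgn1C (cardsD1 s S) bs exprS.
  by ring: (sgn2 _ (sD S)) (sgn2 _ (sD T)).
- rewrite !mul0r mulr0 mul0r scale0r addr0.
  have -> : (S :|: T) :\ s = S :\ s :|: T.
    apply/setP => u; rewrite !inE; case: eqP => // ->.
    by rewrite (negPf cs).
  rewrite inE bs /=; congr (_ *: _); have [-> _] := sgn_s S bs T.
  have [dST|ndST] := boolP [disjoint S :\ s & T]; last first.
    by rewrite [sgn (_ :\ _) T]sgn0 //; ring.
  by rewrite sgnUr //; ring: (sgn2 T cs).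
- rewrite !mul0r scale0r add0r.
  have -> : (S :|: T) :\ s = S :|: T :\ s.
    apply/setP => u; rewrite !inE; case: eqP => // ->.
    by rewrite (negPf bs).
  rewrite inE cs orbT /=; congr (_ *: _); have [_ ->] := sgn_s T cs S.
  have [dST|ndST] := boolP [disjoint S & T :\ s]; last first.
    by rewrite [sgn _ (_ :\ _)]sgn0 //; ring.
  by rewrite sgnUr // sgn1C; ring: (sgn2 S bs).
- by rewrite inE (negPf bs) (negPf cs) !(mul0r, mulr0) !scale0r addr0.
Qed.

Hypothesis (pF : p \in [pchar F]).

Lemma mbin_split i (a b : 'I_n -> nat) :
  mbin a b = 'C(a i + b i, a i)%:R
    * \prod_(j < n | j != i) 'C(a j + b j, a j)%:R.
Proof. by rewrite /multibin (bigD1 i). Qed.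

(** Since [m] times the coefficient is a multiple of [p ^ e], a coefficient prime to [p] would force
    [p ^ e] to divide the smaller positive number [m]. *)
Lemma bin_pchar_pow m e : (0 < m < p ^ e)%N -> 'C(p ^ e, m)%:R = 0 :> F.
Proof.
case/andP=> m_gt0 lt_m; have p_pr := pcharf_prime pF.
apply/eqP; rewrite -(dvdn_pcharf pF).
have e_gt0 : (0 < p ^ e)%N by rewrite expn_gt0 prime_gt0.
have := mul_bin_diag (p ^ e) m.-1; rewrite !prednK // => eqC.
have dvd : (p ^ e %| m * 'C(p ^ e, m))%N by rewrite -eqC dvdn_mulr.
apply: contraLR lt_m => nd; rewrite -leqNgt dvdn_leq //.
by move: dvd; rewrite Gauss_dvdl // coprimeXl // prime_coprime.
Qed.

(** In range this is Pascal's rule for the exponents of the variable [i]. Characteristic [p] enters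
    where truncation at [p ^ t i] begins. *)
Lemma partial_even_omul i f g :
  d (inl i) (mul f g) = mul (d (inl i) f) g + mul f (d (inl i) g).
Proof.
elim/obasis_ind: f => [|a f f' IH IH'|b].
- by rewrite !(omul0l, linear0) add0r.
- by rewrite omulPl !linearP /= !omulPl IH IH' /= !scalerDr addrACA.
elim/obasis_ind: g => [|a g g' IH IH'|c].
- by rewrite !(omul0r, linear0) add0r.
- by rewrite omulPr !linearP /= ?omulPr IH IH' /= !scalerDr addrACA.
rewrite omul_monomial !partial_even // linearZ /=.
pose del (a : 'I_n -> nat) j := (a j - (j == i))%N.
pose a j : nat := b.1 j; pose a' j : nat := c.1 j.
rewrite -/a -/a'.
have -> : mul (if b.1 i == 0%N :> nat then 0 else mono (del a) b.2) (ob c)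
   = (if b.1 i == 0%N :> nat then 0 else sgn b.2 c.2 * mbin (del a) a')
       *: mono (del (fun j => a j + a' j)%N) (b.2 :|: c.2).
  case: ifP => [|/negbT]; first by rewrite omul0l scale0r.
  rewrite -lt0n => bi; rewrite omul_monomial; congr (_ *: _).
  by apply: eq_monomial => j; rewrite /del; case: eqP => [->|_]; rewrite ?addnBAC ?subn0.
have -> : mul (ob b) (if c.1 i == 0%N :> nat then 0 else mono (del a') c.2)
   = (if c.1 i == 0%N :> nat then 0 else sgn b.2 c.2 * mbin a (del a'))
       *: mono (del (fun j => a j + a' j)%N) (b.2 :|: c.2).
  case: ifP => [|/negbT]; first by rewrite omul0r scale0r.
  rewrite -lt0n => ci; rewrite omul_monomial; congr (_ *: _).
  by apply: eq_monomial => j; rewrite /del; case: eqP => [->|_]; rewrite ?addnBA ?subn0.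
rewrite -scalerDl.
have pascal : (0 < a i + a' i)%N ->
   (if b.1 i == 0%N :> nat then 0 else sgn b.2 c.2 * mbin (del a) a')
   + (if c.1 i == 0%N :> nat then 0 else sgn b.2 c.2 * mbin a (del a'))
   = sgn b.2 c.2 * mbin a a'.
  rewrite !(mbin_split i).
  have restl : \prod_(j < n | j != i) 'C(del a j + a' j, del a j)%:R
      = \prod_(j < n | j != i) 'C(a j + a' j, a j)%:R :> F.
    by apply: eq_bigr => j /negPf neji; rewrite /del neji subn0.
  have restr : \prod_(j < n | j != i) 'C(a j + del a' j, a j)%:R
      = \prod_(j < n | j != i) 'C(a j + a' j, a j)%:R :> F.
    by apply: eq_bigr => j /negPf neji; rewrite /del neji subn0.
  rewrite restl restr /del eqxx /a /a'; move: (\prod_(j < n | _) _) => R.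
  case: (nat_of_ord (b.1 i)) (nat_of_ord (c.1 i)) => [|x] [|y] //= _.
  - by rewrite !add0n !bin0 add0r.
  - by rewrite !addn0 !subn1 /= !binn addr0.
  rewrite !subn1 /= (_ : 'C(x.+1 + y.+1, x.+1) = 'C(x + y.+1, x) + 'C(x.+1 + y, x.+1))%N.
    by rewrite natrD; ring.
  by rewrite addSn binS addnC addSnnS.
case: (posnP (a i + a' i)) => [ai0|ai_gt0].
  have := ai0; rewrite /a /a' => /eqP; rewrite addn_eq0 => /andP[-> ->].
  rewrite addr0 scale0r.
  case: (monomialP F p t (fun j => a j + a' j)%N (b.2 :|: c.2)) => [[j out]|].
    by rewrite (monomial_out F _ out) linear0 scaler0.
  case=> e [-> ee _]; rewrite partial_even // ee ai0 /=.
  by rewrite scaler0.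
rewrite pascal //.
case: (ltnP (a i + a' i) (p ^ t i)) => [lt|ge].
  by rewrite partial_even //; case: eqP => // e0; rewrite e0 in ai_gt0.
rewrite [mono _ _ in LHS](monomial_out F _ ge) linear0 scaler0.
(* Strictly above [p ^ t i] the lowered monomial is also out of range. At equality it survives, but
   its coefficient is a binomial coefficient of [p ^ t i], which vanishes in [F]. *)
move: ge; rewrite leq_eqVlt => /orP[/eqP eqp|gt]; last first.
  by rewrite (@monomial_out _ _ _ _ _ _ _ i) ?scaler0 // /del eqxx; lia.
rewrite (mbin_split i) -eqp bin_pchar_pow ?(mul0r, mulr0) ?scale0r //.
have := ltn_ord (b.1 i); have := ltn_ord (c.1 i); rewrite -/(a i) -/(a' i); lia.
Qed.

End Superderivations.

(** * Integer gradings and homogeneous operators *)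

Section Gradings.

Variables (F : fieldType) (p n k : nat) (t : 'I_n -> nat).
Local Notation O := (Onk F p k t).
Local Notation idx := (basis_idx p k t).
Local Notation mono := (@monomial F p n k t).
Local Notation ob := (@obasis F p n k t).
Local Notation mul := (@omul F p n k t).
Local Notation d := (partial F p t).

Variables (u : 'I_n -> int) (v : 'I_k -> int).

(** The weights of the variables are arbitrary, so that the toral weight, the degree used to kill
    brackets, the Euler degree and the number of odd variables are all instances. *)
Definition weight (a : 'I_n -> nat) (S : {set 'I_k}) : int :=
  \sum_i u i * (a i)%:Z + \sum_(s in S) v s.

Definition bweight (b : idx) : int := weight (fun i => b.1 i) b.2.

Definition var_weight (r : var n k) : int :=
  match r with inl i => u i | inr s => v s end.

Definition pure (m : int) (f : O) := forall c, f c != 0 -> bweight c = m.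

Definition homog (m : int) (D : 'End(O)) :=
  forall b, pure (bweight b + m) (D (ob b)).

Lemma pure0 m : pure m 0.
Proof. by move=> c; rewrite ffunE eqxx. Qed.

Lemma pureD m f g : pure m f -> pure m g -> pure m (f + g).
Proof.
move=> hf hg c; have [fc0|/hf //] := eqVneq (f c) 0.
by rewrite ffunE fc0 add0r => /hg.
Qed.

Lemma pureZ m a f : pure m f -> pure m (a *: f).
Proof. by move=> hf c; rewrite ffunE mulf_eq0 negb_or => /andP[_ /hf]. Qed.

Lemma pure_sum m I r (P : pred I) (f : I -> O) :
  (forall i, P i -> pure m (f i)) -> pure m (\sum_(i <- r | P i) f i).
Proof. by move=> hf; elim/big_ind: _ => //; [exact: pure0 | exact: pureD]. Qed.

Lemma pure_monomial a S : pure (weight a S) (mono a S).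
Proof.
move=> c; rewrite ffunE; case: forallP => [eqa|]; last by rewrite eqxx.
case: (c.2 =P S) => [eqS _|]; last by rewrite eqxx.
rewrite /bweight eqS /weight; congr (_ + _).
by apply: eq_bigr => i _; rewrite (eqP (eqa i)).
Qed.

Lemma weightD a a' (S S' : {set 'I_k}) : [disjoint S & S'] ->
  weight (fun i => (a i + a' i)%N) (S :|: S') = weight a S + weight a' S'.
Proof.
move=> dSS'; rewrite /weight addrACA -big_split; congr (_ + _) => /=.
  by apply: eq_bigr => i _; rewrite -mulrDr.
by rewrite (eq_bigl [predU S & S']) ?bigU // => s; rewrite !inE.
Qed.

Lemma pure_omul m m' f g : pure m f -> pure m' g -> pure (m + m') (mul f g).
Proof.
move=> hf hg; apply: pure_sum => c _.
have [->|/hg <-] := eqVneq (g c) 0; first by rewrite scale0r; apply: pure0.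
apply/pureZ/pure_sum => b _.
have [->|/hf <-] := eqVneq (f b) 0; first by rewrite scale0r; apply: pure0.
apply: pureZ; rewrite /basis_mul; case: ifP => [dbc|_]; last exact: pure0.
by apply: pureZ; rewrite /bweight -weightD //; apply: pure_monomial.
Qed.

Lemma homog_pure m a D f : homog m D -> pure a f -> pure (a + m) (D f).
Proof.
move=> hD hf; rewrite [f]obasis_expand linear_sum; apply: pure_sum => b _.
have [->|/hf <-] := eqVneq (f b) 0; last by rewrite linearZ; apply: pureZ.
by rewrite scale0r linear0; apply: pure0.
Qed.

Lemma homog0 m : homog m 0.
Proof. by move=> b; rewrite zero_lfunE; apply: pure0. Qed.

Lemma homogD m D E : homog m D -> homog m E -> homog m (D + E).
Proof. by move=> hD hE b; rewrite add_lfunE; apply: pureD. Qed.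

Lemma homogZ m a D : homog m D -> homog m (a *: D).
Proof. by move=> hD b; rewrite scale_lfunE; apply: pureZ. Qed.

Lemma homogB m D E : homog m D -> homog m E -> homog m (D - E).
Proof. by move=> hD hE; rewrite -scaleN1r; apply/homogD/homogZ. Qed.

Lemma homog_sum m I r (P : pred I) (D : I -> 'End(O)) :
  (forall i, P i -> homog m (D i)) -> homog m (\sum_(i <- r | P i) D i).
Proof. by move=> hD; elim/big_ind: _ => //; [exact: homog0 | exact: homogD]. Qed.

Lemma homog_comp m m' D E : homog m D -> homog m' E -> homog (m' + m) (D \o E).
Proof.
by move=> hD hE b; rewrite comp_lfunE addrA; apply: homog_pure => //; apply: hE.
Qed.

Lemma opmulE (f : O) D g : opmul f D g = mul f (D g).
Proof. by rewrite /opmul comp_lfunE lfunE. Qed.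

Lemma homog_opmul m m' f D : pure m f -> homog m' D -> homog (m + m') (opmul f D).
Proof.
by move=> hf hD b; rewrite opmulE addrCA; apply: pure_omul => //; apply: hD.
Qed.

Lemma homog_partial r : homog (- var_weight r) (d r).
Proof.
move=> b; rewrite partial_obasis; case: r => [i|s] /=.
  case: ifP => [_|/negbT b0]; first exact: pure0.
  suff -> : bweight b - u i = weight (fun j => b.1 j - (j == i))%N b.2.
    exact: pure_monomial.
  rewrite /bweight /weight addrAC (bigD1 i) //= [in RHS](bigD1 i) //= eqxx.
  congr (_ + _); rewrite addrAC; congr (_ + _).
    by rewrite -subzn ?lt0n // mulrBr mulr1.
  by apply: eq_bigr => j /negPf->; rewrite subn0.
case: ifP => [bs|_]; last exact: pure0; apply: pureZ.
suff -> : bweight b - v s = weight (fun j => b.1 j) (b.2 :\ s).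
  exact: pure_monomial.
rewrite /bweight /weight -addrA; congr (_ + _).
by rewrite (big_setD1 s) //= addrC addKr.
Qed.

Lemma pure_ovar r : pure (var_weight r) (ovar F p t r).
Proof.
suff -> : var_weight r = match r with
    inl i => weight (fun j => (j == i : nat)) set0
  | inr s => weight (fun=> 0%N) [set s] end.
  by case: r => [i|s]; apply: pure_monomial.
case: r => [i|s]; rewrite /weight /= ?big_set0 ?big_set1.
  rewrite addr0 (bigD1 i) //= eqxx mulr1 big1 ?addr0 // => j /negPf->.
  by rewrite mulr0.
by rewrite big1 ?add0r // => i _; rewrite mulr0.
Qed.

Definition diagonal (W : 'End(O)) :=
  forall b, W (ob b) = (bweight b)%:~R *: ob b.

Lemma diagonal_pure W m f : diagonal W -> pure m f -> W f = m%:~R *: f.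
Proof.
move=> hW hf; rewrite [f]obasis_expand linear_sum scaler_sumr.
apply: eq_bigr => b _; rewrite linearZ /= hW.
have [->|/hf <-] := eqVneq (f b) 0; first by rewrite !scale0r scaler0.
by rewrite !scalerA mulrC.
Qed.

(** On a component of degree a, [W] acts as a before [D] is applied and as a + m afterwards. *)
Lemma diagonal_comm W m D f : diagonal W -> homog m D ->
  W (D f) = D (W f) + m%:~R *: D f.
Proof.
move=> hW hD.
have /lfunP/(_ f) : (W \o D = D \o W + m%:~R *: D)%VF.
  apply: lfun_obasis_eq => b; rewrite add_lfunE scale_lfunE !comp_lfunE.
  by rewrite (diagonal_pure hW (hD b)) hW linearZ -scalerDl intrD.
by rewrite add_lfunE scale_lfunE !comp_lfunE.
Qed.

End Gradings.

(** * Action and homogeneity of Hamiltonian and contact fields *)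

Section HamiltonianContact.

Variables (F : fieldType) (p n : nat) (t : 'I_n -> nat).

Section Hamiltonian.

Variables (k : nat) (le_nk : (n <= k)%N).
Local Notation O := (Onk F p k t).
Local Notation idx := (basis_idx p k t).
Local Notation mono := (@monomial F p n k t).
Local Notation ob := (@obasis F p n k t).
Local Notation mul := (@omul F p n k t).
Local Notation d := (partial F p t).
Local Notation hv := (hvar le_nk).
Local Notation sigma := (sigma F p k t).

(** Carries the sign attached to the parities of the derivative and of the generating function. *)
Definition sigma_if (e : bool) : 'End(O) := if e then sigma else \1%VF.

Lemma TH_obasis b : TH le_nk (ob b) = TH_basis F le_nk b.
Proof. exact: linext_obasis. Qed.

Lemma TH_apply a g :
  TH le_nk a g =
    \sum_i mul (d (hv i) (sigma_if (odd_idx i) a)) (d (hv (prime_idx i)) g).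
Proof.
elim/obasis_ind: a => [|c a a' IH IH'|b].
- rewrite linear0 zero_lfunE big1 // => i _.
  by rewrite !linear0 omul0l.
- rewrite linearP add_lfunE scale_lfunE IH IH' scaler_sumr -big_split.
  by apply: eq_bigr => i _; rewrite !linearP /= omulPl.
rewrite TH_obasis /TH_basis sum_lfunE; apply: eq_bigr => i _.
rewrite scale_lfunE opmulE -omulZl -linearZ; congr (mul (d _ _) _).
rewrite /sigma_if; case: odd_idx; first by rewrite sigma_monomial mul1n.
by rewrite id_lfunE scale1r.
Qed.

Definition var_deg (r : var n k) (b : idx) : nat :=
  match r with inl i => b.1 i | inr s => s \in b.2 end.

(** For an even variable the factor is the binomial of b over 1 produced by multiplying the lowered
    monomial back; for an odd one the two sorting signs cancel. *)
Lemma ovar_partial r b :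
  mul (ovar F p t r) (d r (ob b)) = (var_deg r b)%:R *: ob b.
Proof.
case: r => [i|s] /=.
  rewrite partial_even //; case: eqP => [->|/eqP b0].
    by rewrite omul0r scale0r.
  rewrite omul_monomial sgn_set0l set0U mul1r (mbin_split _ i) big1.
    rewrite mulr1 eqxx subnKC ?lt0n // bin1; congr (_ *: _).
    apply: eq_monomial => j; case: eqP => [->|_]; last by rewrite add0n subn0.
    by rewrite subnKC ?lt0n.
  by move=> j /negPf->; rewrite add0n bin0.
rewrite partial_odd omulZr omul_monomial scalerA.
rewrite /multibin big1 => [|i _]; last by rewrite add0n bin0.
case: (boolP (s \in b.2)) => bs; last by rewrite !mul0r !scale0r.
rewrite mulr1 mul1r sgn_sqr; last by rewrite disjoints1 !inE eqxx.
by rewrite setD1K //; congr (_ *: _); apply: eq_monomial.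
Qed.

Variables (u : 'I_n -> int) (v : 'I_k -> int) (c : int).
Hypothesis uv_c : forall j, u j + v (widen_ord le_nk j) = c.

(** Each summand differentiates once by a variable and once by its conjugate, and by [uv_c] such a
    pair has total weight [c]. *)
Lemma homog_TH b : homog u v (bweight u v b - c) (TH le_nk (ob b)).
Proof.
rewrite TH_obasis; apply: homog_sum => i _; apply: homogZ.
have -> : bweight u v b - c = bweight u v b - var_weight u v (hv i)
    - var_weight u v (hv (prime_idx i)).
  by case: i => j /=; rewrite -(uv_c j); ring.
apply: homog_opmul; last exact: homog_partial.
exact: homog_partial.
Qed.

Lemma homog_eulerD : homog u v 0 (eulerD F p t le_nk).
Proof.
apply: homog_sum => i _; rewrite -(subrr (var_weight u v (hv i))).
by apply: homog_opmul; [exact: pure_ovar | exact: homog_partial].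
Qed.

End Hamiltonian.

Local Notation O := (Onk F p n.+1 t).
Local Notation mono := (@monomial F p n n.+1 t).
Local Notation ob := (@obasis F p n n.+1 t).
Local Notation mul := (@omul F p n n.+1 t).
Local Notation d := (partial F p t).
Local Notation dlast := (partial F p t (inr ord_max : var n n.+1)).
Local Notation sigma := (sigma F p n.+1 t).
Local Notation DD := (eulerD F p t (leqnSn n)).

Lemma TK_obasis b : TK (ob b) = TK_basis F b.
Proof. exact: linext_obasis. Qed.

Lemma TK_apply a g :
  TK a g = TH (leqnSn n) a g + mul (dlast (sigma a)) (DD g)
           + mul (DD a - 2%:R *: a) (dlast g).
Proof.
have linD (f h : O -> O) : linear f -> linear h -> linear (fun a => f a + h a).
  by move=> lf lh c x y; rewrite lf lh scalerDr addrACA.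
have linT : linear (fun a => TH (leqnSn n) a g).
  by move=> c x y; rewrite linearP add_lfunE scale_lfunE.
have linS : linear (fun a => mul (dlast (sigma a)) (DD g)).
  by move=> c x y; rewrite !linearP omulPl.
have linE : linear (fun a => mul (DD a - 2%:R *: a) (dlast g)).
  move=> c x y; rewrite linearP /= [2%:R *: (_ + _)]scalerDr scalerA mulrC.
  by rewrite -scalerA opprD addrACA -scalerBr omulPl.
have linK : linear (fun a => TK a g).
  by move=> c x y; rewrite linearP add_lfunE scale_lfunE.
have := linD _ _ (linD _ _ linT linS) linE; move: linK.
set lhs := fun a => TK a g; set rhs := fun a => _ + _ => linL linR.
rewrite -[LHS]/(lhs a) -[RHS]/(rhs a).
have lin0 (f : O -> O) : linear f -> f 0 = 0.
  by move/(_ (-1) 0 0); rewrite scaler0 addr0 scaleN1r addNr.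
elim/obasis_ind: a => [|c a a' IH IH'|b]; first by rewrite !lin0.
  by rewrite linL linR IH IH'.
rewrite /lhs /rhs.
rewrite TK_obasis /TK_basis !add_lfunE scale_lfunE !opmulE; congr (_ + _ + _).
by rewrite sigma_monomial linearZ /= omulZl.
Qed.

(** The two terms beyond the Hamiltonian one differentiate by the last variable and have an Euler
    factor of weight 0, so that variable must weigh as much as a conjugate pair. *)
Lemma homog_TK (u : 'I_n -> int) (v : 'I_n.+1 -> int) c b :
  (forall j, u j + v (widen_ord (leqnSn n) j) = c) -> v ord_max = c ->
  homog u v (bweight u v b - c) (TK (ob b)).
Proof.
move=> uv_c vc; rewrite TK_obasis; apply: homogD; first apply: homogD.
- exact: homog_TH.
- apply: homogZ; rewrite -[_ - c]addr0; apply: homog_opmul; last exact: homog_eulerD.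
  by rewrite -vc; apply: homog_partial.
apply: homog_opmul; last by rewrite -vc; apply: homog_partial.
apply: pureD; last by rewrite -scaleNr; apply/pureZ/pure_monomial.
by rewrite -[bweight _ _ _]addr0; apply: homog_eulerD.
Qed.

(** The Euler field sums the degree-counting operators of all variables but the last, which
    therefore gets weight 0. *)
Lemma eulerD_diagonal :
  diagonal (fun=> 1) (fun s : 'I_n.+1 => (s != ord_max)%:Z) DD.
Proof.
move=> b; rewrite /eulerD sum_lfunE.
under eq_bigr do rewrite opmulE ovar_partial.
rewrite -scaler_suml -natr_sum pmulrn big_sumType /= PoszD; congr (_%:~R *: _).
rewrite /bweight /weight -!natz !natr_sum; congr (_ + _).
  by apply: eq_bigr => i _; rewrite natz mul1r.
rewrite [RHS]big_mkcond big_ord_recr /= eqxx if_same addr0.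
apply: eq_bigr => j _; rewrite -val_eqE /= (ltn_eqF (ltn_ord j)).
by case: (_ \in _).
Qed.

End HamiltonianContact.

Lemma eq_widen_ord n k (le_nk : (n <= k)%N) (i j : 'I_n) :
  (widen_ord le_nk i == widen_ord le_nk j) = (i == j).
Proof. by []. Qed.

(** * Even derivations acting on Hamiltonian fields, and the toral element *)

Section MoreDerivations.

Variables (F : fieldType) (p n k : nat) (t : 'I_n -> nat).
Local Notation O := (Onk F p k t).
Local Notation mono := (@monomial F p n k t).
Local Notation ob := (@obasis F p n k t).
Local Notation mul := (@omul F p n k t).
Local Notation d := (partial F p t).
Local Notation sigma := (sigma F p k t).
Local Notation xi s := (ovar F p t (inr s : var n k)).
Local Notation one := (mono (fun=> 0%N) set0).

Lemma sigmaK f : sigma (sigma f) = f.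
Proof.
suff /lfunP/(_ f) : (sigma \o sigma = \1)%VF by rewrite comp_lfunE id_lfunE.
apply: lfun_obasis_eq => b; rewrite comp_lfunE id_lfunE !sigma_monomial linearZ.
by rewrite /= sigma_monomial scalerA -expr2 sqrr_sign scale1r.
Qed.

Lemma sigma_xi s : sigma (xi s) = - xi s.
Proof. by rewrite sigma_monomial cards1 scaleN1r. Qed.

Lemma omul1r f : mul f one = f.
Proof.
elim/obasis_ind: f => [|a f f' IH IH'|b].
- by rewrite omul0l.
- by rewrite omulPl IH IH'.
rewrite [ob b]/obasis omul_monomial sgn_set0r setU0 /multibin big1 => [|i _].
  by rewrite mul1r scale1r; apply: eq_monomial => i; rewrite addn0.
by rewrite addn0 binn.
Qed.

Lemma partial_odd_sqr s (f : O) : d (inr s) (d (inr s) f) = 0.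
Proof.
suff /lfunP/(_ f) : (d (inr s) \o d (inr s) = 0)%VF.
  by rewrite comp_lfunE zero_lfunE.
apply: lfun_obasis_eq => b; rewrite comp_lfunE zero_lfunE.
by rewrite partial_odd linearZ /= partial_odd !inE eqxx mul0r scale0r scaler0.
Qed.

Lemma partial_odd_xi r s : d (inr r) (xi s) = (r == s)%:R *: one.
Proof.
rewrite partial_odd inE; case: eqP => [->|_]; last by rewrite mul0r !scale0r.
by rewrite setDv sgn_set0r mulr1.
Qed.

Lemma partial_even_xi j s : d (inl j) (xi s) = 0.
Proof.
case: (monomialP F p t (fun=> 0%N) [set s]) => [[i out]|].
  by rewrite /= (@monomial_out F p n k t (fun=> 0%N) [set s] i out) linear0.
by case=> b [/= -> eb _]; rewrite partial_obasis /= eb.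
Qed.

(** The absence of a sign is the Leibniz rule of an even superderivation. *)
Definition derivation (A : 'End(O)) :=
  forall f g, A (mul f g) = mul (A f) g + mul f (A g).

Variables (le_nk : (n <= k)%N) (i0 : 'I_n).
Local Notation hv := (hvar le_nk).
Local Notation T := (TH le_nk).

(** [B] measures the failure of [A] to commute with the derivative by the odd conjugate of [i0]: it
    is 0 for HO and the last derivative for KO. That derivative occurs once on [a] and once on [g],
    whence the two corrections. *)
Lemma derivation_TH (A B : 'End(O)) : derivation A ->
  (forall f, A (sigma f) = sigma (A f)) ->
  (forall i f, A (d (hv i) f) =
                 d (hv i) (A f) - (if i == inr i0 then B f else 0)) ->
  forall a g, A (T a g) = T (A a) g - mul (B (sigma a)) (d (inl i0) g)
                          + (T a (A g) - mul (d (inl i0) a) (B g)).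
Proof.
move=> derA As Ad a g; rewrite !TH_apply linear_sum /=.
have As' e f : A (sigma_if F p t k e f) = sigma_if F p t k e (A f).
  by case: e; rewrite /= ?id_lfunE.
pose G (i : 'I_n + 'I_n) := if i == inr i0 then mul (B (sigma a)) (d (inl i0) g) else 0.
pose H (i : 'I_n + 'I_n) := if i == inl i0 then mul (d (inl i0) a) (B g) else 0.
have sG : \sum_i G i = mul (B (sigma a)) (d (inl i0) g).
  by rewrite -big_mkcond big_pred1_eq.
have sH : \sum_i H i = mul (d (inl i0) a) (B g).
  by rewrite -big_mkcond big_pred1_eq.
rewrite -sG -sH -!sumrB -big_split; apply: eq_bigr => i _ /=.
rewrite derA !Ad As' omulDl omulDr omulNl omulNr; congr (_ - _ + (_ - _)).
  rewrite /G; case: eqP => [->|_]; last by rewrite omul0l.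
  by [].
rewrite /H; case: i => j /=; last by rewrite omul0r.
rewrite (inj_eq inr_inj) (inj_eq inl_inj).
by case: eqP => [->|_]; rewrite ?omul0r ?id_lfunE.
Qed.

Lemma TH_xi g : T (xi (widen_ord le_nk i0)) g = - d (inl i0) g.
Proof.
rewrite TH_apply (bigD1 (inr i0)) //= big1 => [|i nei].
  by rewrite sigma_xi linearN /= partial_odd_xi eqxx scale1r omulNl omul1l addr0.
case: i nei => j /=.
  by rewrite id_lfunE partial_even_xi omul0l.
rewrite (inj_eq inr_inj) => nej; rewrite sigma_xi linearN /= partial_odd_xi.
by rewrite eq_widen_ord (negPf nej) scale0r oppr0 omul0l.
Qed.

Definition toral_u (j : 'I_n) : int := (j == i0)%:Z.
Definition toral_v (s : 'I_k) : int := - (s == widen_ord le_nk i0)%:Z.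

(** The element h of the overview, a variable times its odd conjugate. *)
Definition toral := mono (fun j => (j == i0 : nat)) [set widen_ord le_nk i0].

Hypothesis pt_gt1 : forall i, (1 < p ^ t i)%N.

Lemma partial_even_toral j :
  d (inl j) toral = (j == i0)%:R *: xi (widen_ord le_nk i0).
Proof.
rewrite partial_even; last by rewrite (leq_ltn_trans (leq_b1 _)).
case: (j =P i0) => [->|_]; last by rewrite scale0r.
by rewrite scale1r; apply: eq_monomial => i; rewrite subnn.
Qed.

Lemma partial_odd_toral s :
  d (inr s) toral = (s == widen_ord le_nk i0)%:R *: ovar F p t (inl i0).
Proof.
rewrite partial_odd inE; case: eqP => [->|_]; last by rewrite mul0r !scale0r.
by rewrite setDv sgn_set0r mulr1.
Qed.

Lemma sigma_toral : sigma toral = - toral.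
Proof. by rewrite sigma_monomial cards1 scaleN1r. Qed.

(** Only the two summands of the pair [i0] survive. After the change of sign they are the counting
    operator of the even variable minus that of its odd conjugate. *)
Lemma diagonal_TH_toral : diagonal toral_u toral_v (- T toral).
Proof.
move=> b; rewrite opp_lfunE TH_apply big_sumType /=.
rewrite (bigD1 i0) //= big1 => [|j nej]; last first.
  by rewrite id_lfunE partial_even_toral (negPf nej) scale0r omul0l.
rewrite (bigD1 i0) //= big1 => [|j nej]; last first.
  rewrite sigma_toral linearN /= partial_odd_toral eq_widen_ord (negPf nej).
  by rewrite scale0r oppr0 omul0l.
rewrite id_lfunE partial_even_toral sigma_toral linearN /= partial_odd_toral.
have xb : mul (mono (fun=> 0%N) [set widen_ord le_nk i0])
    (d (inr (widen_ord le_nk i0)) (ob b)) =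
    (widen_ord le_nk i0 \in b.2)%:R *: ob b by exact: ovar_partial (inr _) b.
rewrite !eqxx !scale1r omulNl ovar_partial /= xb !addr0 opprD opprK.
rewrite -scaleNr -scalerDl; congr (_ *: _); rewrite addrC.
rewrite /bweight /weight (bigD1 i0) //= big1 => [|j nej]; last first.
  by rewrite /toral_u (negPf nej) mul0r.
rewrite /toral_u eqxx mul1r addr0 intrD -pmulrn; congr (_ + _).
case: (boolP (_ \in _)) => bs.
  rewrite (big_setD1 _ bs) /= big1 => [|s]; last first.
    by rewrite !inE /toral_v => /andP[/negPf->].
  by rewrite /toral_v eqxx addr0 intrN.
rewrite big1 ?oppr0 // => s bs'; rewrite /toral_v; case: eqP => // es.
by rewrite es in bs'; rewrite bs' in bs.
Qed.

End MoreDerivations.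

(** * The even derivation attached to an odd variable in the contact case *)

Section Contact.

Variables (F : fieldType) (p n : nat) (t : 'I_n -> nat).
Hypothesis pF : p \in [pchar F].

Local Notation O := (Onk F p n.+1 t).
Local Notation mono := (@monomial F p n n.+1 t).
Local Notation ob := (@obasis F p n n.+1 t).
Local Notation mul := (@omul F p n n.+1 t).
Local Notation d := (partial F p t).
Local Notation dlast := (partial F p t (inr ord_max : var n n.+1)).
Local Notation sigma := (sigma F p n.+1 t).
Local Notation DD := (eulerD F p t (leqnSn n)).

Variable i0 : 'I_n.
Local Notation s0 := (widen_ord (leqnSn n) i0).
Local Notation xi := (ovar F p t (inr s0 : var n n.+1)).

Lemma widen_neq_max (j : 'I_n) : (widen_ord (leqnSn n) j == ord_max) = false.
Proof. by rewrite -val_eqE /= (ltn_eqF (ltn_ord j)). Qed.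

Definition xiD : 'End(O) := opmul xi dlast.
Definition contactD : 'End(O) := d (inl i0) + xiD.

Lemma xiDE f : xiD f = mul xi (dlast f). Proof. exact: opmulE. Qed.

Lemma contactDE f : contactD f = d (inl i0) f + mul xi (dlast f).
Proof. by rewrite add_lfunE xiDE. Qed.

(** The [sigma] in the Leibniz rule of the last derivative is absorbed when the odd coefficient [xi]
    is moved past [f]. *)
Lemma contactD_derivation : derivation contactD.
Proof.
move=> f g; rewrite !contactDE partial_even_omul // partial_odd_omul omulDr.
rewrite -(omulA _ (sigma f)) -omul_xiC omulA.
by rewrite [in RHS]omulDl [in RHS]omulDr (omulA xi) addrACA.
Qed.

Lemma contactD_sigma f : contactD (sigma f) = sigma (contactD f).
Proof.
rewrite !contactDE linearD /= sigma_partial_even sigma_omul sigma_xi.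
by rewrite sigma_partial_odd omulNl omulNr opprK.
Qed.

(** The defect arises when the derivative by the odd conjugate of [i0] hits the coefficient [xi] of
    [contactD]. *)
Lemma contactD_partial i f :
  contactD (d (hvar (leqnSn n) i) f) =
    d (hvar (leqnSn n) i) (contactD f) - (if i == inr i0 then dlast f else 0).
Proof.
rewrite !contactDE linearD; case: i => j /=.
  rewrite subr0 partial_even_omul // partial_even_xi omul0l add0r.
  by rewrite partial_even_comm partial_even_odd_comm.
rewrite partial_odd_omul sigma_xi omulNl -partial_even_odd_comm.
rewrite (partial_odd_anticomm _ ord_max) omulNr opprK partial_odd_xi.
rewrite (inj_eq inr_inj) eq_widen_ord.
case: eqP => _; last by rewrite scale0r omul0l add0r subr0.
rewrite scale1r omul1l -[RHS]addrA; congr (_ + _).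
by rewrite addrAC subrr add0r.
Qed.

Lemma contactD_dlast f : contactD (dlast f) = dlast (contactD f).
Proof.
rewrite !contactDE linearD /= partial_odd_omul partial_odd_sqr !omul0r.
by rewrite partial_odd_xi eq_sym widen_neq_max scale0r omul0l !addr0
  partial_even_odd_comm.
Qed.

(** The two parts of [contactD] have Euler degrees -1 and 1, so [diagonal_comm] applies to each. *)
Lemma contactD_eulerD f :
  contactD (DD f) = DD (contactD f) + d (inl i0) f - mul xi (dlast f).
Proof.
pose u (j : 'I_n) : int := 1; pose v (s : 'I_n.+1) : int := (s != ord_max)%:Z.
have hd : homog u v (-1) (d (inl i0)) by apply: homog_partial.
have hx : homog u v 1 xiD.
  rewrite (_ : 1 = var_weight u v (inr s0) - var_weight u v (inr ord_max)).
    apply: homog_opmul; [exact: pure_ovar | exact: homog_partial].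
  by rewrite /= /v widen_neq_max eqxx.
have := diagonal_comm f (@eulerD_diagonal F p n t) hd.
have := diagonal_comm f (@eulerD_diagonal F p n t) hx.
rewrite !xiDE scaleN1r scale1r => h2 h1.
rewrite !contactDE linearD /= h1 h2.
move: (d _ _) (mul xi _) (d _ _) (mul xi _) => x y z w.
by apply/ffunP => c; rewrite !ffunE; ring.
Qed.

(** The defects of the Hamiltonian part cancel against the terms in the even derivative from
    [contactD_eulerD]; the terms with [xi] cancel among themselves. *)
Lemma contactD_TK a g :
  contactD (TK a g) = TK (contactD a) g + TK a (contactD g).
Proof.
have AD x y : contactD (x + y) = contactD x + contactD y by exact: linearD.
have AE : contactD (DD a - 2%:R *: a) =
    (DD (contactD a) - 2%:R *: contactD a) + d (inl i0) a - mul xi (dlast a).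
  rewrite linearB linearZ /= contactD_eulerD [RHS]addrAC; apply/eqP.
  by rewrite -subr_eq0; apply/eqP/ffunP => c; rewrite !ffunE; ring.
rewrite !TK_apply !AD.
rewrite (derivation_TH contactD_derivation contactD_sigma contactD_partial).
rewrite !contactD_derivation AE !contactD_dlast contactD_sigma contactD_eulerD.
(* Moving [xi] to the front applies [sigma] to the derivative of [sigma a], and [sigma] anticommutes
   with an odd derivative. *)
have sq : mul (dlast (sigma a)) (mul xi (dlast g)) = - mul (mul xi (dlast a)) (dlast g).
  rewrite -omulA omul_xiC sigma_partial_odd sigmaK omulNr omulNl.
  by [].
rewrite !(omulDl, omulNl, omulDr, omulNr) sq.
move: (TH _ _ _) (TH _ _ _).
move: (mul _ _) (mul _ _) (mul _ _) (mul _ _) (mul _ _) (mul _ _) (mul _ _) (mul _ _).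
move=> *.
apply/ffunP => c; rewrite !ffunE; ring.
Qed.

Lemma eulerD_xi : DD xi = xi.
Proof.
rewrite (diagonal_pure (@eulerD_diagonal F p n t) (@pure_ovar F p n _ t _ _ _)).
by rewrite /var_weight widen_neq_max scale1r.
Qed.

(** As [xi] has Euler degree 1, the coefficient of the last derivative is 1 - 2 times [xi]. *)
Lemma TK_xi g : TK xi g = - contactD g.
Proof.
rewrite TK_apply TH_xi sigma_xi linearN /= partial_odd_xi eq_sym widen_neq_max.
rewrite scale0r oppr0 omul0l addr0.
rewrite eulerD_xi contactDE opprD; congr (_ + _).
have subr2 (x : O) : x - 2%:R *: x = - x.
  by rewrite scaler_nat mulr2n opprD addNKr.
by rewrite subr2 omulNl.
Qed.

Hypothesis pt_gt1 : forall i, (1 < p ^ t i)%N.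
Local Notation toral := (toral F p t (leqnSn n) i0).

(** The toral element does not involve the last variable and has Euler degree 2, so both contact
    terms vanish. *)
Lemma TK_toral : TK toral = TH (leqnSn n) toral.
Proof.
apply/lfunP => g; rewrite TK_apply sigma_toral linearN /= partial_odd_toral.
rewrite eq_sym widen_neq_max scale0r oppr0 omul0l addr0.
rewrite (diagonal_pure (@eulerD_diagonal F p n t) (@pure_monomial F p n n.+1 t _ _ _ _)).
rewrite /weight (bigD1 i0) //= big1 => [|j /negPf->]; last by rewrite mulr0.
by rewrite big_set1 widen_neq_max eqxx subrr omul0l addr0.
Qed.

End Contact.

(** * Supercommutators with an even argument *)

Section Supercommutator.

Variables (F : fieldType) (V : vectType F) (P Q : bool -> 'End(V)).
Variable D : 'End(V).

Local Notation supercommutator :=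
  (\sum_(b : bool) \sum_(c : bool)
    ((P b \o Q c)%VF - (-1) ^+ (b && c) *: (Q c \o P b)%VF)).

(** The sign is nontrivial only for two odd components, and here one argument has none. *)
Lemma supercommutator_evenr : Q false = D -> Q true = 0 ->
  supercommutator =
    (((P false + P true) \o D) - (D \o (P false + P true)))%VF.
Proof.
move=> Q0 Q1; rewrite !big_bool /= Q0 Q1 !comp_lfun0r !comp_lfun0l.
rewrite !scaler0 !subr0 !scale1r !add0r addrC addrACA -opprD.
by rewrite comp_lfunDl comp_lfunDr.
Qed.

Lemma supercommutator_evenl : P false = D -> P true = 0 ->
  supercommutator =
    ((D \o (Q false + Q true)) - ((Q false + Q true) \o D))%VF.
Proof.
move=> P0 P1; rewrite !big_bool /= P0 P1 !comp_lfun0r !comp_lfun0l.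
rewrite !scaler0 !subr0 !scale1r !add0r addrC addrACA -opprD.
by rewrite comp_lfunDl comp_lfunDr.
Qed.

End Supercommutator.

(** * Degeneracy of associative forms, for HO and KO at once *)

Section Form.

Variables (F : fieldType) (p n k : nat) (t : 'I_n -> nat).
Local Notation O := (Onk F p k t).
Local Notation idx := (basis_idx p k t).
Local Notation mono := (@monomial F p n k t).
Local Notation ob := (@obasis F p n k t).
Local Notation mul := (@omul F p n k t).
Local Notation d := (partial F p t).
Local Notation pr := (oparity F p k t).
Local Notation sb := (superbracket pr).

Lemma homog_oparity u v e : homog u v 0 (pr e).
Proof.
move=> b; rewrite oparity_obasis addr0; case: ifP => _; last exact: pure0.
exact: pure_monomial.
Qed.

Lemma homog_end_part u v m e D : homog u v m D -> homog u v m (end_part pr e D).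
Proof.
move=> hD; apply: homog_sum => b _.
rewrite -[m]add0r; apply: homog_comp; last exact: homog_oparity.
by rewrite -[m]addr0; apply: homog_comp; first exact: homog_oparity.
Qed.

Lemma homog_superbracket u v m m' D E :
  homog u v m D -> homog u v m' E -> homog u v (m + m') (sb D E).
Proof.
move=> hD hE; apply: homog_sum => b _; apply: homog_sum => c _.
apply: homogB; last apply: homogZ.
  by rewrite addrC; apply: homog_comp; apply: homog_end_part.
by apply: homog_comp; apply: homog_end_part.
Qed.

Lemma oparity_sum f : pr false f + pr true f = f.
Proof.
suff /lfunP/(_ f) : (pr false + pr true = \1)%VF.
  by rewrite add_lfunE id_lfunE.
apply: lfun_obasis_eq => b; rewrite add_lfunE id_lfunE !oparity_obasis.
by case: odd; rewrite /= ?addr0 ?add0r.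
Qed.

Lemma end_part_sum D : end_part pr false D + end_part pr true D = D.
Proof.
apply/lfunP => f; rewrite add_lfunE /end_part !sum_lfunE !big_bool /=.
rewrite !comp_lfunE /= addrACA [X in X + _]addrC !oparity_sum.
by rewrite -linearD /= [X in D X]addrC oparity_sum.
Qed.

Lemma bweight_parity (b : idx) : bweight (fun=> 0) (fun=> 1) b = #|b.2|%:Z.
Proof.
rewrite /bweight /weight big1 ?add0r => [|i _]; last by rewrite mul0r.
by rewrite sumr_const natz.
Qed.

(** An operator preserving the number of odd variables preserves parity. *)
Lemma end_part_even D : homog (fun=> 0) (fun=> 1) 0 D ->
  end_part pr false D = D /\ end_part pr true D = 0.
Proof.
move=> hD; have odd0 : end_part pr true D = 0; last first.
  by split=> //; rewrite -[RHS]end_part_sum odd0 addr0.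
apply: lfun_obasis_eq => b; rewrite zero_lfunE /end_part sum_lfunE big1 //.
move=> e _; rewrite !comp_lfunE oparity_obasis.
case: eqP => [eb|_]; last by rewrite !linear0.
rewrite [D _]obasis_expand linear_sum big1 //= => c _.
have [->|/hD] := eqVneq (D (ob b) c) 0; first by rewrite scale0r linear0.
rewrite addr0 !bweight_parity => -[ecb].
by rewrite linearZ /= oparity_obasis ecb eb addbT; case: (e); rewrite scaler0.
Qed.

Lemma superbracket_evenr D E : homog (fun=> 0) (fun=> 1) 0 E ->
  sb D E = ((D \o E) - (E \o D))%VF.
Proof.
case/end_part_even => E0 E1.
rewrite -[in RHS](end_part_sum D).
exact: (supercommutator_evenr (fun b => end_part pr b D) E0 E1).
Qed.

Lemma superbracket_evenl D E : homog (fun=> 0) (fun=> 1) 0 D ->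
  sb D E = ((D \o E) - (E \o D))%VF.
Proof.
case/end_part_even => D0 D1.
rewrite -[in RHS](end_part_sum E).
exact: (supercommutator_evenl (fun b => end_part pr b E) D0 D1).
Qed.

Variables (i0 : 'I_n) (le_nk : (n <= k)%N).
Local Notation s0 := (widen_ord le_nk i0).
Local Notation uh := (toral_u i0).
Local Notation vh := (toral_v le_nk i0).

(** Combined with [toral_u], this gives every conjugate pair, and the extra odd variable of KO,
    total weight 1. *)
Definition degree_v (s : 'I_k) : int := (s != s0)%:Z.
Local Notation wh b := (bweight uh vh b).
Local Notation wg b := (bweight uh degree_v b).

Hypotheses (pF : p \in [pchar F]) (p_gt3 : (3 < p)%N).
Hypothesis t_gt0 : forall i, (0 < t i)%N.

Lemma pt_gt1 i : (1 < p ^ t i)%N.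
Proof. by rewrite -(expn0 p) ltn_exp2l // (ltn_trans _ p_gt3). Qed.

Lemma top_lt i : ((p ^ t i).-1 < p ^ t i)%N.
Proof. by rewrite prednK // (ltn_trans _ (pt_gt1 i)). Qed.

Definition top : idx :=
  ([ffun i => Ordinal (top_lt i)] : {dffun forall i : 'I_n, 'I_(p ^ t i)}, setT).

Lemma wgE (b : idx) : wg b = (b.1 i0)%:Z + #|b.2 :\ s0|%:Z.
Proof.
rewrite /bweight /weight (bigD1 i0) //= big1 => [|j /negPf nej]; last first.
  by rewrite /toral_u nej mul0r.
rewrite /toral_u eqxx mul1r addr0; congr (_ + _).
rewrite -[RHS]natz -sumr_const big_mkcond [RHS]big_mkcond; apply: eq_bigr => s _.
by rewrite !inE /degree_v; case: eqP; case: (s \in _).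
Qed.

Lemma whE (b : idx) : wh b = (b.1 i0)%:Z - (s0 \in b.2)%:Z.
Proof.
rewrite /bweight /weight (bigD1 i0) //= big1 => [|j /negPf nej]; last first.
  by rewrite /toral_u nej mul0r.
rewrite /toral_u eqxx mul1r addr0; congr (_ + _).
rewrite big_mkcond (bigD1 s0) //= big1 ?addr0 /toral_v ?eqxx.
  by case: (_ \in _); rewrite ?oppr0.
by move=> s /negPf->; rewrite oppr0 if_same.
Qed.

Lemma wg_ge0 (b : idx) : 0 <= wg b. Proof. by rewrite wgE; lia. Qed.

Lemma wg_le_top (b : idx) : wg b <= wg top.
Proof.
rewrite !wgE /= ffunE /= lerD // lez_nat; last exact/subset_leq_card/setSD/subsetT.
by rewrite -ltnS prednK ?ltn_ord // (ltn_trans _ (pt_gt1 i0)).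
Qed.

(** All degrees lie between 0 and that of [top], so a larger shift has no possible target. *)
Lemma homog_top_eq0 m (D : 'End(O)) : wg top < m -> homog uh degree_v m D -> D = 0.
Proof.
move=> lt_m hD; apply: lfun_obasis_eq => b; rewrite zero_lfunE.
apply/ffunP => c; rewrite ffunE; apply/eqP; apply: contraTT lt_m => /hD eqc.
by have := wg_le_top c; have := wg_ge0 b; rewrite eqc -leNgt; lia.
Qed.

(* For p >= 5, weight 2 forces the exponent to be 2 or 3 modulo p, so it stays *)
(* off the top degree p^t - 1 and b is in the image of d_1.                   *)
Lemma weight2_integral (b : idx) : (wh b)%:~R = 2%:R :> F ->
  exists y : idx, [/\ d (inl i0) (ob y) = ob b, y.2 = b.2
                      & 3 <= wg y].
Proof.
have nz m : (0 < m < 5)%N -> m%:R != 0 :> F.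
  case/andP=> m_gt0 m_lt5; rewrite -(dvdn_pcharf pF).
  apply/negP => /dvdn_leq; move/(_ m_gt0) => le_pm.
  have p4 : p = 4%N by lia.
  by have := pcharf_prime pF; rewrite p4.
rewrite whE intrD intrN -!pmulrn => wh2.
set e := (s0 \in b.2) in wh2.
have ha : (b.1 i0)%:R = (2 + e)%:R :> F.
  by rewrite natrD -wh2 subrK.
have b_ge2 : (1 < b.1 i0)%N.
  rewrite ltnNge; apply/negP => le1.
  (* An exponent at most 1 would make a number from 1 to 3 vanish in [F]. *)
  have := nz (2 + e - b.1 i0)%N; rewrite natrB ?ha ?subrr ?eqxx.
    by case: (e) le1 => le1 /(_ _) => h; have : false by apply: h; lia.
  by lia.
have b_lt : ((b.1 i0).+1 < p ^ t i0)%N.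
  rewrite ltn_neqAle ltn_ord andbT; apply/eqP => eb.
  (* If the exponent were maximal, its successor would be 0 in [F], yet it equals 3 or 4 there. *)
  have := nz (3 + e)%N.
  have -> : (3 + e)%:R = (p ^ t i0)%:R :> F.
    by rewrite -eb -[RHS]natr1 ha natr1.
  rewrite natrX pcharf0 // expr0n (gtn_eqF (t_gt0 i0)) eqxx.
  by case: (e) => /(_ isT).
have lt_a j : (b.1 j + (j == i0) < p ^ t j)%N.
  by case: eqP => [->|_]; rewrite ?addn1 ?addn0.
have [y [ey ey1 ey2]] := monomial_obasis F b.2 lt_a.
exists y; have y0 : y.1 i0 = (b.1 i0).+1 :> nat by rewrite ey1 eqxx addn1.
split=> //; last by rewrite wgE y0; lia.
rewrite partial_even // y0 /= ey2 /obasis; apply: eq_monomial => j.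
by rewrite ey1 addnK.
Qed.

(** [T] stands for [TH] or [TK], and [A] for the even derivative or [contactD]; the hypotheses below
    are the common interface of the two cases. *)
Variable T : {linear O -> 'End(O)}.
Local Notation X := (limg (linfun T)).
Variables (A : 'End(O)).
Local Notation toral := (mono (fun j => (j == i0 : nat)) [set s0]).
Local Notation xi := (ovar F p t (inr s0 : var n k)).

Hypothesis T_homog : forall u v c b,
  (forall j, u j + v (widen_ord le_nk j) = c) ->
  (forall s : 'I_k, (n <= s)%N -> v s = c) ->
  homog u v (bweight u v b - c) (T (ob b)).
Hypothesis T_toral : diagonal uh vh (- T toral).
Hypothesis T_xi : T xi = - A.
Hypothesis T_A : forall a g, A (T a g) = T (A a) g + T a (A g).
Hypothesis T_top : T (ob top) != 0.
(** Excludes the extra odd variable of KO; for HO it holds for every [b]. *)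
Definition old_vars (b : idx) := forall s : 'I_k, s \in b.2 -> (s < n)%N.

Hypothesis A_old : forall b y, old_vars b ->
  d (inl i0) (ob y) = ob b -> y.2 = b.2 -> A (ob y) = ob b.
(* For KO, c b' is the term x_(1') d_(2n+1) y, which is free of x_(2n+1). *)
Hypothesis A_new : forall b y,
  d (inl i0) (ob y) = ob b -> y.2 = b.2 ->
  exists c b', old_vars b' /\ A (ob y) = c *: ob b' + ob b.

Definition emb (a : O) : subvs_of X := vsproj X (T a).

Lemma embP c a b : emb (c *: a + b) = c *: emb a + emb b.
Proof. by rewrite /emb !linearP. Qed.

Lemma vsval_emb a : vsval (emb a) = T a.
Proof. by rewrite vsprojK // -[T a]lfunE memv_img // memvf. Qed.

Variable lam : {biscalar subvs_of X}.
Hypothesis lamA : associative_form pr lam.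
Local Notation phi a := (lam (emb (ob top)) (emb a)).

Lemma lam_bracket a b c :
  lam (vsproj X (sb (T a) (T b))) (emb c) = lam (emb a) (vsproj X (sb (T b) (T c))).
Proof. by have := lamA (emb a) (emb b) (emb c); rewrite /sub_bracket !vsval_emb. Qed.

(** The toral weights of conjugate variables are opposite, so the shift constant is 0; for
    [T_homog_g] and [T_even] it is 1. *)
Lemma T_homog_h (b : idx) : homog uh vh (wh b) (T (ob b)).
Proof.
rewrite -[wh b]subr0; apply: T_homog => [j|s le_ns].
  by rewrite /toral_v eq_widen_ord subrr.
rewrite /toral_v -val_eqE /=; case: eqP => //= es.
by have := ltn_ord i0; rewrite -es ltnNge le_ns.
Qed.

Lemma T_homog_g (b : idx) : homog uh degree_v (wg b - 1) (T (ob b)).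
Proof.
apply: T_homog => [j|s le_ns].
  by rewrite /degree_v eq_widen_ord /toral_u; case: eqP.
rewrite /degree_v -val_eqE /=; case: eqP => //= es.
by have := ltn_ord i0; rewrite -es ltnNge le_ns.
Qed.

Lemma T_even (b : idx) : #|b.2| = 1 -> homog (fun=> 0) (fun=> 1) 0 (T (ob b)).
Proof.
move=> b1; have := @T_homog (fun=> 0) (fun=> 1) 1 b.
by rewrite bweight_parity b1 subrr; apply.
Qed.

Lemma toral_obasis : exists2 h : idx, mono (fun j => (j == i0 : nat)) [set s0] = ob h
  & h.2 = [set s0].
Proof.
have lt_h j : ((j == i0) < p ^ t j)%N.
  by rewrite (leq_ltn_trans _ (pt_gt1 j)) // leq_b1.
by have [h [eh _ h2]] := monomial_obasis F [set s0] lt_h; exists h.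
Qed.

(** Placing the toral field in the middle of the associativity law gives that the weight of [top]
    plus that of [b] annihilates the value of the form. *)
Lemma lam_weight b : (wh b)%:~R != 2%:R :> F -> phi (ob b) = 0.
Proof.
move=> wb; have [h eh h2] := toral_obasis.
have evh : homog (fun=> 0) (fun=> 1) 0 (T (ob h)) by apply: T_even; rewrite h2 cards1.
have comm (c : idx) :
    ((T (ob c) \o T (ob h)) - (T (ob h) \o T (ob c)) = (wh c)%:~R *: T (ob c))%VF.
  apply/lfunP => g; have := diagonal_comm g T_toral (@T_homog_h c).
  rewrite eh !opp_lfunE linearN add_lfunE opp_lfunE scale_lfunE !comp_lfunE => e.
  by rewrite [LHS]addrC e addrAC addNr add0r.
have sbt : sb (T (ob top)) (T (ob h)) = (wh top)%:~R *: T (ob top).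
  by rewrite superbracket_evenr.
have sbb : sb (T (ob h)) (T (ob b)) = - ((wh b)%:~R *: T (ob b)).
  by rewrite superbracket_evenl // -opprB comm.
have := lam_bracket (ob top) (ob h) (ob b); rewrite sbt sbb.
rewrite linearZ linearN linearZ /= -/(emb (ob top)) -/(emb (ob b)).
rewrite linearZl_LR linearNr linearZr_LR /=.
(* The maximal exponent is -1 in [F], and the odd conjugate variable contributes another -1. *)
have -> : (wh top)%:~R = - 2%:R :> F.
  rewrite whE /= in_setT ffunE /= intrD intrN -!pmulrn.
  have -> : (p ^ t i0).-1%:R = -1 :> F.
    apply/eqP; rewrite eq_sym -subr_eq0 -opprD addrC natr1 oppr_eq0.
    rewrite prednK ?(ltn_trans _ (pt_gt1 i0)) // natrX pcharf0 // expr0n.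
    by rewrite (gtn_eqF (t_gt0 i0)).
  by ring.
move/eqP; rewrite mulNr eqr_opp -subr_eq0 -mulrBl mulf_eq0 subr_eq0 eq_sym.
by rewrite (negPf wb) => /eqP.
Qed.

(** The bracket of the fields of [y] and [xi] is that of [A y]; moving the bracket to the left side
    pairs [xi] with a bracket that is zero by degree. *)
Lemma lam_integral y : 3 <= wg y -> phi (A (ob y)) = 0.
Proof.
move=> wy; have [x [ex _ x2]] : exists x : idx, [/\ xi = ob x,
    forall i, x.1 i = 0%N :> nat & x.2 = [set s0]].
  by apply: monomial_obasis => i; rewrite (ltn_trans _ (pt_gt1 i)).
have evx : homog (fun=> 0) (fun=> 1) 0 (T (ob x)) by apply: T_even; rewrite x2 cards1.
have sb0 : sb (T (ob top)) (T (ob y)) = 0.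
  (* Here the bound 3 is used: the total shift exceeds the degree of [top]. *)
  apply: (@homog_top_eq0 (wg top - 1 + (wg y - 1))); first by lia.
  by apply: homog_superbracket; apply: T_homog_g.
have := lam_bracket (ob top) (ob y) (ob x).
rewrite sb0 linear0 linear0l superbracket_evenr // -ex T_xi => e.
rewrite {}[RHS]e; congr (lam _ _); rewrite /emb; congr (vsproj _ _).
apply/lfunP => g; rewrite add_lfunE opp_lfunE !comp_lfunE opp_lfunE linearN.
by rewrite opp_lfunE opprK T_A addrC addrK.
Qed.

Lemma lam_top_eq0 b : phi (ob b) = 0.
Proof.
have [wb|/lam_weight //] := eqVneq (wh b)%:~R (2%:R : F).
have [y [dy y2 wy]] := weight2_integral wb.
(* Monomials without the extra odd variable come first, since for them [A] inverts the integration
   exactly; they then remove the error term of the general case. *)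
have old b' : old_vars b' -> phi (ob b') = 0.
  move=> oldb'; have [wb'|/lam_weight //] := eqVneq (wh b')%:~R (2%:R : F).
  have [y' [dy' y2' wy']] := weight2_integral wb'.
  by rewrite -(A_old oldb' dy' y2') lam_integral.
have [c [b' [oldb' eA]]] := A_new dy y2.
have := lam_integral wy; rewrite eA embP linearPr /= old // => <-.
by rewrite mulr0 add0r.
Qed.

(** The nonzero field of [top] pairs to zero with every element, as the fields of monomials span
    [X]. *)
Lemma associative_form_degenerate : ~ nondegenerate_form lam.
Proof.
case=> nondeg _; suff top0 : emb (ob top) = 0.
  by have := T_top; rewrite -vsval_emb top0 linear0 eqxx.
apply: nondeg => y.
have /memv_imgP[a _ ey] : vsval y \in X by apply: subvsP.
have -> : y = emb a by rewrite -[LHS]vsvalK ey lfunE.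
elim/obasis_ind: a {ey} => [|c a a' IH IH'|b]; last exact: lam_top_eq0.
  by rewrite /emb !linear0.
by rewrite embP linearPr /= IH IH' mulr0 addr0.
Qed.

End Form.

(** * Verification of the hypotheses for HO and KO *)

Section Instances.

Variables (F : fieldType) (p n : nat) (t : 'I_n -> nat) (i0 : 'I_n).
Hypotheses (pF : p \in [pchar F]) (p_gt3 : (3 < p)%N).
Hypothesis t_gt0 : forall i, (0 < t i)%N.

(** Evaluating at the odd conjugate variable recovers a derivative of the generating function; this
    detects that the field of [top] is nonzero. *)
Lemma TH_apply_xi k (le_nk : (n <= k)%N) (a : Onk F p k t) :
  TH le_nk a (ovar F p t (inr (widen_ord le_nk i0))) = partial F p t (inl i0) a.
Proof.
rewrite TH_apply (bigD1 (inl i0)) //= big1 => [|i nei].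
  by rewrite id_lfunE partial_odd_xi eqxx scale1r omul1r addr0.
case: i nei => j /=; last by rewrite partial_even_xi omul0r.
rewrite (inj_eq inl_inj) => nej.
by rewrite partial_odd_xi eq_widen_ord (negPf nej) scale0r omul0r.
Qed.

Lemma partial_top_neq0 k :
  partial F p t (inl i0) (obasis F (top k p_gt3 t_gt0)) != 0.
Proof.
have lt1 := pt_gt1 p_gt3 t_gt0 i0.
rewrite partial_even ?ffunE /= //; last by rewrite prednK // ltnW.
have lt_a j : ((p ^ t j).-1 - (j == i0) < p ^ t j)%N.
  by have := pt_gt1 p_gt3 t_gt0 j; lia.
have [y [ey _ _]] := monomial_obasis F ([set: 'I_k]) lt_a.
case: (_ =P 0%N) => [e1|_]; first by lia.
rewrite (_ : monomial _ _ _ _ _ = obasis F y).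
  apply/eqP => /ffunP/(_ y); rewrite obasisE ffunE eqxx => /eqP.
  by rewrite oner_eq0.
by rewrite -ey; apply: eq_monomial => j; rewrite ffunE.
Qed.

Lemma HO_form_degenerate (lam : {biscalar subvs_of (HO F p t)}) :
  associative_form (oparity F p n t) lam -> ~ nondegenerate_form lam.
Proof.
move=> lamA; pose A := partial F p t (inl i0 : var n n).
apply: (@associative_form_degenerate F p n n t i0 (leqnn n) pF p_gt3 t_gt0
  (TH (leqnn n) : {linear _ -> _}) A).
- by move=> u v c b uv_c _; apply: homog_TH.
- exact/diagonal_TH_toral/pt_gt1.
- by apply/lfunP => g; rewrite TH_xi opp_lfunE.
- move=> a g.
  (* The defect is zero, since the even derivative commutes with all derivatives. *)
  rewrite (@derivation_TH F p n n t (leqnn n) i0 A 0).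
  + by rewrite !zero_lfunE omul0l omul0r !subr0.
  + exact: partial_even_omul.
  + by move=> f; rewrite sigma_partial_even.
  + move=> i f; rewrite zero_lfunE if_same subr0; case: i => j.
      exact: partial_even_comm.
    exact: partial_even_odd_comm.
- have := partial_top_neq0 n; rewrite -(TH_apply_xi (leqnn n)).
  by apply: contraNneq => ->; rewrite zero_lfunE.
- by [].
- move=> b y dy _; exists 0, b; split; first by move=> s _; apply: ltn_ord.
  by rewrite scale0r add0r.
exact: lamA.
Qed.

Lemma KO_form_degenerate (lam : {biscalar subvs_of (KO F p t)}) :
  associative_form (oparity F p n.+1 t) lam -> ~ nondegenerate_form lam.
Proof.
move=> lamA.
apply: (@associative_form_degenerate F p n n.+1 t i0 (leqnSn n) pF p_gt3 t_gt0
  (@TK F p n t : {linear _ -> _}) (contactD F p t i0)).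
- move=> u v c b uv_c v_c; apply: homog_TK => //.
  exact: v_c.
- by rewrite /= TK_toral; apply/diagonal_TH_toral/pt_gt1.
- by apply/lfunP => g; rewrite TK_xi opp_lfunE.
- exact: contactD_TK.
- have := partial_top_neq0 n.+1; apply: contraNneq => T0.
  (* Evaluated at [xi], the Euler term has [xi] twice and the last term differentiates [xi] by
     another variable, so only the Hamiltonian part remains. *)
  have := TK_apply (obasis F (top n.+1 p_gt3 t_gt0))
    (ovar F p t (inr (widen_ord (leqnSn n) i0))).
  rewrite T0 zero_lfunE TH_apply_xi eulerD_xi partial_odd_xi eq_sym widen_neq_max.
  rewrite scale0r omul0r addr0 sigma_monomial linearZ /= partial_odd !omulZl.
  rewrite omul_monomial [sort_sign F (_ :\ _) _]sgn0.
    by rewrite mul0r scale0r !scaler0 addr0 => <-.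
  apply/pred0Pn; exists (widen_ord (leqnSn n) i0).
  by rewrite /= !inE widen_neq_max eqxx.
- move=> b y oldb dy y2; rewrite contactDE dy partial_odd y2.
  case: (boolP (ord_max \in b.2)) => [/oldb|_]; first by rewrite ltnn.
  by rewrite mul0r scale0r omul0r addr0.
- move=> b y dy y2; rewrite contactDE dy partial_odd omulZr omul_monomial.
  rewrite scalerA addrC.
  (* The error monomial is [y] with the last odd variable replaced by the conjugate of [i0]; its
     coefficient, a product of signs that may be zero, is found by unification. *)
  eexists; exists (y.1, widen_ord (leqnSn n) i0 |: y.2 :\ ord_max); split.
    move=> s; rewrite !inE => /orP[/eqP->|/andP[nes _]]; first exact: (ltn_ord i0).
    by rewrite ltn_neqAle -ltnS ltn_ord andbT.
  by congr (_ *: _ + _); apply: eq_monomial => j; rewrite add0n.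
exact: lamA.
Qed.

End Instances.

Theorem theorem2p3 (F : closedFieldType) (p : nat) (hp : p \in [pchar F])
    (hp3 : (3 < p)%N) (n : nat) (hn : (0 < n)%N) (t : 'I_n -> nat)
    (ht : forall i, (0 < t i)%N) :
  (simple_superalgebra (oparity F p n t) (HO F p t) ->
   forall lam : {biscalar subvs_of (HO F p t)},
     associative_form (oparity F p n t) lam -> ~ nondegenerate_form lam)
  /\
  (simple_superalgebra (oparity F p n.+1 t) (KO F p t) ->
   forall lam : {biscalar subvs_of (KO F p t)},
     associative_form (oparity F p n.+1 t) lam -> ~ nondegenerate_form lam).
Proof.
split=> _ lam.
  exact: (HO_form_degenerate (Ordinal hn) hp hp3 ht).
exact: (KO_form_degenerate (Ordinal hn) hp hp3 ht).
Qed.
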